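(* Let $k\ge3$ and $t\in V_1\otimes\cdots\otimes V_k$ a complex tensor. If $\theta\in\mathcal{P}(B)$, then $\widetilde{\mathrm{MSR}}(t)\le F^\theta(t)$. If $\theta$ is supported on bipartitions of the form $\{\{j\},[k]\setminus\{j\}\}$, then $\widetilde{\mathrm{SR}}(t)\le F^\theta(t)$.
   Context: All vector spaces are finite-dimensional complex; $[k]=\{1,\dots,k\}$, $\overline S=[k]\setminus S$, $V_S=\bigotimes_{j\in S}V_j$; $B$ is the set of bipartitions $\{S,\overline S\}$ ($S,\overline S$ nonempty), $\mathcal{P}(B)$ the probability distributions on $B$. A slice is a tensor $v\otimes w$ with $v\in V_j$, $w\in V_{\overline{\{j\}}}$ for some $j$; a multi-slice is $v\otimes w$ with $v\in V_S$, $w\in V_{\overline S}$ for some $S\subseteq[k]$. Slice rank $\mathrm{SR}(t)$ (resp. multi-slice rank $\mathrm{MSR}(t)$) is the least number of slices (resp. multi-slices) summing to $t$. With $t^{\otimes n}$ viewed as a $k$-tensor in $V_1^{\otimes n}\otimes\cdots\otimes V_k^{\otimes n}$: $\widetilde{\mathrm{SR}}(t)=\limsup_n\mathrm{SR}(t^{\otimes n})^{1/n}$, $\widetilde{\mathrm{MSR}}(t)=\limsup_n\mathrm{MSR}(t^{\otimes n})^{1/n}$. Upper quantum functional: Schur–Weyl $V^{\otimes n}\cong\bigoplus_{\lambda\vdash n}\mathbb{S}_\lambda(V)\otimes[\lambda]$, $P^V_\lambda$ projection onto the $\lambda$-isotypic component; for $S\subseteq[k]$, $P^{V_S}_\lambda$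 acts on $(V_{[k]})^{\otimes n}\cong(V_S)^{\otimes n}\otimes(V_{\overline S})^{\otimes n}$ as $P^{V_S}_\lambda\otimes\mathrm{Id}$; $P^{V_b}_\lambda=P^{V_S}_\lambda\cdot\frac1{n!}\sum_{\pi\in S_n}\pi$ for $b=\{S,\overline S\}$. With $\operatorname{supp}\theta=\{b_1,\dots,b_\ell\}$ in a fixed order and $\overline\lambda=(\lambda_1/n,\dots)$, $E^\theta(t)=\sup\sum_i\theta(b_i)H(\overline{\lambda^{(b_i)}})$ ($H$ Shannon entropy base 2) over $n\ge1$ and $\lambda^{(b_i)}\vdash n$ with $P^{V_{b_\ell}}_{\lambda^{(b_\ell)}}\cdots P^{V_{b_1}}_{\lambda^{(b_1)}}t^{\otimes n}\ne0$; $F^\theta=2^{E^\theta}$, $F^\theta(0)=0$. *)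

(* Defs.v *)
From HB Require Import structures.
From mathcomp Require Import all_boot all_order all_algebra all_fingroup.
From mathcomp Require Import all_classical all_reals all_analysis.
From mathcomp Require Import complex.

Set Implicit Arguments.
Unset Strict Implicit.
Unset Printing Implicit Defensive.

Import Order.TTheory GRing.Theory Num.Theory.

Local Open Scope ring_scope.

(* The complex numbers are R[i] for an arbitrary model R of the reals.
   Vector spaces are given in coordinates: [cspace R X] is the complex vector
   space with basis indexed by the finite type [X].  The tensor product of
   [cspace R X] and [cspace R Y] is [cspace R (X * Y)], and likewise for other
   (dependent) products of index types. *)
Definition cspace (R : realType) (X : finType) := {ffun X -> (R[i])^o}.

(* Basis of V_[k], where V_j has basis I j. *)
Definition legs (k : nat) (I : 'I_k -> finType) : finType :=
  {dffun forall j : 'I_k, I j}.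

(* Basis of V_S. *)
Definition legs_on (k : nat) (I : 'I_k -> finType) (S : {set 'I_k}) : finType :=
  {dffun forall j : {j : 'I_k | j \in S}, I (val j)}.

Definition tensor (R : realType) (k : nat) (I : 'I_k -> finType) :=
  cspace R (legs I).

Section Slices.
Variables (R : realType) (k : nat) (I : 'I_k -> finType).

Definition restr (S : {set 'I_k}) (x : legs I) : legs_on I S :=
  [ffun j : {j : 'I_k | j \in S} => x (val j)].

Definition is_slice (t : tensor R I) : Prop :=
  exists (j : 'I_k) (v : cspace R (I j)) (w : cspace R (legs_on I (~: [set j]))),
    t = [ffun x : legs I => v (x j) * w (restr (~: [set j]) x)].

(* S and its complement must be nonempty: otherwise every tensor would be a
   multi-slice. *)
Definition is_multislice (t : tensor R I) : Prop :=
  exists S : {set 'I_k}, [/\ S != finset.set0, ~: S != finset.set0 &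
    exists (v : cspace R (legs_on I S)) (w : cspace R (legs_on I (~: S))),
      t = [ffun x : legs I => v (restr S x) * w (restr (~: S) x)]].

Definition is_sum_of (Q : tensor R I -> Prop) (t : tensor R I) (r : nat) : Prop :=
  exists2 s : 'I_r -> tensor R I, forall i, Q (s i) & t = \sum_i s i.

Definition least (A : nat -> Prop) : nat :=
  xget 0%N (fun r => A r /\ forall m, A m -> (r <= m)%N).

Definition slice_rank (t : tensor R I) : nat := least (is_sum_of is_slice t).

Definition multislice_rank (t : tensor R I) : nat :=
  least (is_sum_of is_multislice t).

(* t^{(x) n} as a k-tensor in V_1^{(x) n} (x) ... (x) V_k^{(x) n}. *)
Definition kpower (n : nat) (t : tensor R I) :
    tensor R (fun j => {ffun 'I_n -> I j}) :=
  [ffun y : legs (fun j => {ffun 'I_n -> I j}) =>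
    \prod_(m < n) t [ffun j => y j m]].

(* t^{(x) n} as an element of (V_[k])^{(x) n}. *)
Definition npower (n : nat) (t : tensor R I) : cspace R {ffun 'I_n -> legs I} :=
  [ffun x : {ffun 'I_n -> legs I} => \prod_(m < n) t (x m)].

End Slices.

Section AsymptoticRanks.
Variables (R : realType) (k : nat) (I : 'I_k -> finType).

Definition asymptotic_slice_rank (t : tensor R I) : \bar R :=
  limn_esup (fun n => ((slice_rank (kpower n t))%:R `^ (n%:R^-1))%:E).

Definition asymptotic_multislice_rank (t : tensor R I) : \bar R :=
  limn_esup (fun n => ((multislice_rank (kpower n t))%:R `^ (n%:R^-1))%:E).

End AsymptoticRanks.

Definition is_intpart (n : nat) (lam : seq nat) : bool :=
  [&& sorted geq lam, 0%N \notin lam & sumn lam == n].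

(* The irreducible representation [lambda] of S_n, realized as the left ideal
   C[S_n] c_lambda generated by the Young symmetrizer of the tableau of shape
   lambda filled row by row with 0, ..., n - 1. *)
Section Specht.
Variables (R : realType) (n : nat) (lam : seq nat).

Definition row_group : {set 'S_n} :=
  [set s : 'S_n |
    [forall i : 'I_n, reshape_index lam (s i) == reshape_index lam i]].

Definition col_group : {set 'S_n} :=
  [set s : 'S_n |
    [forall i : 'I_n, reshape_offset lam (s i) == reshape_offset lam i]].

(* Elements of the group algebra C[S_n] are functions on S_n. *)
Definition young_symmetrizer : cspace R 'S_n :=
  [ffun g : 'S_n => \sum_(p in row_group)
    \sum_(q in col_group | (p * q)%g == g) (-1) ^+ (q : bool)].

Definition ltrans (s : 'S_n) (a : cspace R 'S_n) : cspace R 'S_n :=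
  [ffun g => a (s^-1 * g)%g].

Definition specht : {vspace cspace R 'S_n} :=
  <<[seq ltrans s young_symmetrizer | s <- enum 'S_n]>>%VS.

End Specht.

Section SchurWeyl.
Variables (R : realType) (n : nat) (X : finType).

Local Notation W := (cspace R {ffun 'I_n -> X}).

(* Inverting s makes this a left action of 'S_n, whose product satisfies
   (s * s') i = s' (s i). *)
Definition perm_act (s : 'S_n) (w : W) : W :=
  [ffun x : {ffun 'I_n -> X} => w [ffun m => x ((s^-1)%g m)]].

Definition span_of (A : W -> Prop) : {vspace W} :=
  xget 0%VS (fun U : {vspace W} => (forall w, A w -> w \in U) /\
    (forall U' : {vspace W}, (forall w, A w -> w \in U') -> (U <= U')%VS)).

(* The sum of the images of all S_n-equivariant linear maps [lambda] -> W. *)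
Definition isotypic (lam : seq nat) : {vspace W} :=
  span_of (fun w => exists2 f : 'Hom(cspace R 'S_n, W),
    (forall (s : 'S_n) a, a \in specht R n lam ->
       f (ltrans s a) = perm_act s (f a)) &
    w \in (f @: specht R n lam)%VS).

(* Projection onto the lambda-isotypic component along the sum of the other
   isotypic components. *)
Definition isotypic_proj (lam : seq nat) : 'End(W) :=
  daddv_pi (isotypic lam)
    (span_of (fun w => exists mu : seq nat,
       [/\ is_intpart n mu, mu != lam & w \in isotypic mu])).

Definition symmetrize (w : W) : W :=
  (n`!%:R : R[i])^-1 *: \sum_(s : 'S_n) perm_act s w.

End SchurWeyl.

Section Bipartitions.
Variable k : nat.

Definition bipartition : finType :=
  {b : {set {set 'I_k}} | finset.partition b [set: 'I_k] && (#|b| == 2)}.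

(* One of the two blocks of b; which one is irrelevant, see [bipart_proj]. *)
Definition side (b : bipartition) : {set 'I_k} := odflt finset.set0 [pick S in val b].

Definition is_distribution (R : realType) (theta : bipartition -> R) : Prop :=
  (forall b, 0 <= theta b) /\ \sum_b theta b = 1.

Definition is_support_ordering (R : realType) (theta : bipartition -> R)
    (bs : seq bipartition) : Prop :=
  uniq bs /\ forall b, (b \in bs) = (theta b != 0).

Definition singleton_supported (R : realType) (theta : bipartition -> R) : Prop :=
  forall b, theta b != 0 ->
    exists j : 'I_k, val b = [set [set j]; ~: [set j]].

End Bipartitions.

Section QuantumFunctional.
Variables (R : realType) (k : nat) (I : 'I_k -> finType).

Definition override (S : {set 'I_k}) (a : legs_on I S) (x : legs I) : legs I :=
  [ffun j => match @idP (j \in S) with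
             | ReflectT jS => a (exist _ j jS)
             | ReflectF _ => x j
             end].

(* P (x) Id on (V_S)^{(x) n} (x) (V_{~S})^{(x) n} = (V_[k])^{(x) n}. *)
Definition act_on (n : nat) (S : {set 'I_k})
    (P : 'End(cspace R {ffun 'I_n -> legs_on I S}))
    (u : cspace R {ffun 'I_n -> legs I}) : cspace R {ffun 'I_n -> legs I} :=
  [ffun x : {ffun 'I_n -> legs I} =>
    P [ffun a : {ffun 'I_n -> legs_on I S} => u [ffun m => override (a m) (x m)]]
      [ffun m => restr S (x m)]].

(* Either block of b gives the same operator, because [lambda] is self-dual
   and the symmetrizer maps onto the S_n-invariant tensors. *)
Definition bipart_proj (n : nat) (b : bipartition k) (lam : seq nat)
    (u : cspace R {ffun 'I_n -> legs I}) : cspace R {ffun 'I_n -> legs I} :=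
  act_on (isotypic_proj R n (legs_on I (side b)) lam) (symmetrize u).

Definition entropy (n : nat) (lam : seq nat) : R :=
  - \sum_(l <- lam) (l%:R / n%:R) * (ln (l%:R / n%:R) / ln 2).

(* [bs] lists the support of [theta] in the order in which the projections are
   applied. *)
Definition log_upper_functional (theta : bipartition k -> R)
    (bs : seq (bipartition k)) (t : tensor R I) : \bar R :=
  ereal_sup (fun e : \bar R => exists (n : nat) (lam : bipartition k -> seq nat),
    [/\ (0 < n)%N,
        forall b, b \in bs -> is_intpart n (lam b),
        foldl (fun u b => bipart_proj b (lam b) u) (npower n t) bs != 0 &
        e = (\sum_(b <- bs) theta b * entropy n (lam b))%:E]).

Definition upper_functional (theta : bipartition k -> R)
    (bs : seq (bipartition k)) (t : tensor R I) : \bar R :=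
  if t == 0 then 0%E else expeR ((ln 2)%:E * log_upper_functional theta bs t)%E.

End QuantumFunctional.

(* Main.v *)
Require Import Defs.
From HB Require Import structures.
From mathcomp Require Import all_boot all_order all_algebra all_fingroup.
From mathcomp Require Import all_classical all_reals all_analysis.
From mathcomp Require Import complex zify ring lra.

Set Implicit Arguments.
Unset Strict Implicit.
Unset Printing Implicit Defensive.

Import Order.TTheory GRing.Theory Num.Theory.

Local Open Scope ring_scope.

(* Fix a real c bounding E^theta(t).  Decompose t^(x)n along the isotypic
   components of the first bipartition of the support of theta, and keep
   decomposing, along the following bipartitions, those terms whose last
   partition lambda has H(lambda / n) > c.  A term on which the process stops
   has rank at most dim (S_lambda (x) [lambda]) <= poly(n) 2^(nc) across the last
   bipartition; a term on which it never stops would have theta-average entropy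
   greater than c, hence vanishes.  Only partitions with boundedly many parts
   occur, so there are poly(n) terms, and the polynomial factors disappear in
   the limit.

   That the isotypic components of all partitions of n decompose V^(x)n comes
   from the Young symmetrizers: those of distinct shapes annihilate each other,
   so their conjugation averages are linearly independent class functions, and
   there are as many of them as cycle types; hence the unit of the group algebra
   is a combination of them, whose terms act as the isotypic projections. *)

(** * Partitions and tableaux *)

Lemma reshape_index_cons m sh i :
  reshape_index (m :: sh) i =
  (if i < m then 0 else (reshape_index sh (i - m)).+1)%N.
Proof.
rewrite /reshape_index /= subn_eq0; case: ltnP => // le_mi.
by rewrite subSn.
Qed.

Lemma reshape_index_lt sh r i : (i < sumn sh)%N ->
  (reshape_index sh i < r)%N = (i < sumn (take r sh))%N.
Proof.
elim: sh r i => [|m sh IH] [|r] i //= lt_i.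
rewrite reshape_index_cons; case: (ltnP i m) => le_mi; first by rewrite ltn_addr.
by rewrite ltnS IH; [apply/idP/idP; lia | move: lt_i => /=; lia].
Qed.

Lemma sumn_take_le sh r : (sumn (take r sh) <= sumn sh)%N.
Proof. by rewrite -{2}(cat_take_drop r sh) sumn_cat leq_addr. Qed.

Lemma nth_geq_sorted sh i j : sorted geq sh -> (i <= j)%N ->
  (nth 0 sh j <= nth 0 sh i)%N.
Proof.
move=> sh_sorted le_ij; have [lt_j|] := ltnP j (size sh); last first.
  by move=> le_j; rewrite nth_default.
apply: (sorted_leq_nth _ _ 0%N sh_sorted) => //.
- by move=> x y z /= le1 le2; apply: leq_trans le2 le1.
- by move=> x /=.
- by rewrite inE; exact: leq_ltn_trans lt_j.
Qed.

(** The partial sums determine the entries one by one. Excluding zero entries rules out trailing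
    zeros, which the sums do not see. *)
Lemma eq_from_sumn_take lam mu : 0%N \notin lam -> 0%N \notin mu ->
  (forall r, sumn (take r lam) = sumn (take r mu)) -> lam = mu.
Proof.
elim: lam mu => [|x lam IH] [|y mu] //.
- by rewrite inE negb_or => _ /andP[y0 _] /(_ 1%N) /=; rewrite take0 /=; lia.
- by rewrite inE negb_or => /andP[x0 _] _ /(_ 1%N) /=; rewrite take0 /=; lia.
rewrite !inE !negb_or => /andP[_ lam0] /andP[_ mu0] E.
have exy : x = y by have := E 1%N; rewrite /= !take0 /=; lia.
congr cons => //; apply: IH => // r.
by have := E r.+1; rewrite /= exy; lia.
Qed.

Lemma sumn_intpart n lam : is_intpart n lam -> sumn lam = n.
Proof. by case/and3P => _ _ /eqP. Qed.

Lemma card_reshape_index_lt n lam r : sumn lam = n ->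
  #|[set i : 'I_n | reshape_index lam i < r]%N| = sumn (take r lam).
Proof.
move=> lam_n; have le_n : (sumn (take r lam) <= n)%N.
  by rewrite -lam_n sumn_take_le.
have -> : [set i : 'I_n | reshape_index lam i < r]%N =
          [set widen_ord le_n i | i in 'I_(sumn (take r lam))].
  apply/setP => i; rewrite inE reshape_index_lt ?lam_n//.
  apply/idP/imsetP => [lt_i | [j _ ->]]; last exact: (valP j).
  by exists (Ordinal lt_i) => //; apply: val_inj.
by rewrite card_imset ?card_ord //; move=> i j /(congr1 val)/= /val_inj.
Qed.

Lemma reshape_offset_lt n (mu : seq nat) (i : 'I_n) : (reshape_offset mu i < n)%N.
Proof. by rewrite /reshape_offset; have := ltn_ord i; lia. Qed.

(* Every column of mu meets the first r rows of lam at most r times. *)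
Lemma dominated_of_separated n lam mu (s : 'S_n) :
  sumn lam = n -> is_intpart n mu ->
  (forall i j : 'I_n, i != j -> reshape_index lam i = reshape_index lam j ->
     reshape_offset mu (s i) != reshape_offset mu (s j)) ->
  forall r, (sumn (take r lam) <= sumn (take r mu))%N.
Proof.
move=> lam_n mu_part sep [|r]; first by rewrite !take0.
have mu_n := sumn_intpart mu_part; have /and3P[mu_sorted _ _] := mu_part.
rewrite -(card_reshape_index_lt r.+1 lam_n) -(card_reshape_index_lt r.+1 mu_n).
pose col (i : 'I_n) := Ordinal (reshape_offset_lt mu i).
rewrite -!sum1_card (partition_big (col \o s) predT) //=.
rewrite [leqRHS](partition_big col predT) //=.
apply: leq_sum => j _; rewrite !sum1_card.
pose T := [pred i : 'I_n | (i \in [set i : 'I_n | reshape_index lam i < r.+1]%N)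
  && (col (s i) == j)].
pose T' := [pred i : 'I_n | (i \in [set i : 'I_n | reshape_index mu i < r.+1]%N)
  && (col i == j)].
rewrite -[X in (X <= _)%N]/#|T| -[X in (_ <= X)%N]/#|T'|.
(* If column [j] of [mu] reaches below row [r], it meets all of the first [r.+1] rows, while [sep]
   allows at most one element of [T] in each row of [lam]. Otherwise the whole column lies in these
   rows, and [s] embeds [T] into [T']. *)
have [/existsP[m /andP[/eqP col_m row_m]]|/existsPn noex] :=
  boolP [exists m, (col m == j) && (r < reshape_index mu m)%N].
- have : (#|T| <= r.+1)%N.
    have inj : {in T &, injective
        (fun i : 'I_n => inord (reshape_index lam i) : 'I_r.+1)}.
      move=> i i'; rewrite !inE => /andP[row_i col_i] /andP[row_i' col_i'].
      move=> /(congr1 val); rewrite /= !inordK // => row_eq.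
      apply/eqP/negPn/negP => ne_ii'; have := sep _ _ ne_ii' row_eq.
      move: (eqP col_i) (eqP col_i') => /(congr1 val)/= -> /(congr1 val)/= ->.
      by rewrite eqxx.
    by have := leq_card_in _ _ inj; rewrite card_ord.
  move/leq_trans; apply.
  have valid (c : 'I_r.+1) : (j < nth 0 mu c)%N.
    rewrite -col_m /=; apply: (leq_trans (reshape_offsetP _)); first by rewrite mu_n.
    by apply: nth_geq_sorted => //; have := ltn_ord c; lia.
  have lt_n (c : 'I_r.+1) : (flatten_index mu c j < n)%N.
    by have := flatten_indexP (valid c); rewrite mu_n.
  pose g c := Ordinal (lt_n c).
  have g_inj : injective g.
    move=> c c' /(congr1 (fun i : 'I_n => reshape_index mu i)) /=.
    by rewrite !flatten_indexKl // => /val_inj.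
  rewrite -[r.+1]card_ord -(card_imset _ g_inj).
  apply/subset_leq_card/fintype.subsetP => x.
  case/imsetP => c _ ->; rewrite !inE /= flatten_indexKl // ltn_ord /=.
  by apply/eqP/val_inj; rewrite /= flatten_indexKr.
- rewrite -(card_imset T (@perm_inj _ s)); apply/subset_leq_card/fintype.subsetP => x.
  case/imsetP => i; rewrite !inE => /andP[_ col_i] ->; rewrite col_i andbT.
  by have := noex (s i); rewrite col_i /= -leqNgt.
Qed.

(** * Modules over the group algebra of the symmetric group *)

Section GroupAlgebra.
Variables (R : realType) (n : nat).

Local Notation A := (cspace R 'S_n).
Local Notation C := (R[i]).

(** For [rho := ltrans] this is the product of the group algebra, written [conv] below. *)
Definition alg_act (M : lmodType C) (rho : 'S_n -> M -> M) (a : A) (w : M) : M :=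
  \sum_s (a s : C) *: rho s w.

Definition alg_delta (s : 'S_n) : A := [ffun g => (g == s)%:R].

Definition is_repr (M : lmodType C) (rho : 'S_n -> M -> M) : Prop :=
  [/\ forall s, linear (rho s), forall w, rho 1%g w = w &
      forall s s' w, rho (s * s')%g w = rho s (rho s' w)].

Local Notation conv := (alg_act (@ltrans R n)).

Lemma ltrans_repr : is_repr (@ltrans R n : 'S_n -> A -> A).
Proof.
split.
- by move=> s k a b; apply/ffunP => g; rewrite !ffunE.
- by move=> a; apply/ffunP => g; rewrite ffunE invg1 mul1g.
- by move=> s s' a; apply/ffunP => g; rewrite !ffunE invMg mulgA.
Qed.

Lemma perm_act_repr (X : finType) : is_repr (@perm_act R n X).
Proof.
split.
- by move=> s k a b; apply/ffunP => x; rewrite !ffunE.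
- move=> a; apply/ffunP => x; rewrite ffunE; congr (a _).
  by apply/ffunP => m; rewrite ffunE invg1 perm1.
- move=> s s' a; apply/ffunP => x; rewrite !ffunE; congr (a _).
  by apply/ffunP => m; rewrite !ffunE invMg permM.
Qed.

Definition row_sym (lam : seq nat) : A := [ffun g => (g \in row_group n lam)%:R].

Definition col_sym (lam : seq nat) : A :=
  [ffun g : 'S_n => (g \in col_group n lam)%:R * (-1) ^+ (g : bool)].

(** Up to the factor n!, the projection of the group algebra onto its centre, the class
    functions. *)
Definition class_sum (a : A) : A := [ffun h => \sum_g a (h ^ g)%g].

Lemma row_groupP lam (s : 'S_n) :
  reflect (forall i, reshape_index lam (s i) = reshape_index lam i)
          (s \in row_group n lam).
Proof.
by rewrite inE; apply: (iffP forallP) => H i; [exact/eqP | exact/eqP].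
Qed.

Lemma col_groupP lam (s : 'S_n) :
  reflect (forall i, reshape_offset lam (s i) = reshape_offset lam i)
          (s \in col_group n lam).
Proof.
by rewrite inE; apply: (iffP forallP) => H i; [exact/eqP | exact/eqP].
Qed.

Lemma row_group_set lam : group_set (row_group n lam).
Proof.
apply/group_setP; split; first by apply/row_groupP => i; rewrite perm1.
move=> s s' /row_groupP Hs /row_groupP Hs'; apply/row_groupP => i.
by rewrite permM Hs' Hs.
Qed.
Canonical row_group_group lam := Group (row_group_set lam).

Lemma col_group_set lam : group_set (col_group n lam).
Proof.
apply/group_setP; split; first by apply/col_groupP => i; rewrite perm1.
move=> s s' /col_groupP Hs /col_groupP Hs'; apply/col_groupP => i.
by rewrite permM Hs' Hs.
Qed.
Canonical col_group_group lam := Group (col_group_set lam).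

Section Action.
Variables (M : lmodType C) (rho : 'S_n -> M -> M).
Hypothesis rhoP : is_repr rho.

Let rho_lin s : linear (rho s). Proof. by case: rhoP. Qed.

Let rhoM s s' w : rho (s * s')%g w = rho s (rho s' w). Proof. by case: rhoP. Qed.

Let rhoL s : {linear M -> M} :=
  HB.pack (rho s) (GRing.isLinear.Build C M M *:%R (rho s) (rho_lin s)).

Lemma repr0 s : rho s 0 = 0. Proof. exact: (linear0 (rhoL s)). Qed.
Lemma reprN s w : rho s (- w) = - rho s w. Proof. exact: (linearN (rhoL s)). Qed.
Lemma reprZ s k w : rho s (k *: w) = k *: rho s w.
Proof. exact: (linearZ_LR (rhoL s)). Qed.
Lemma repr_sum s (J : finType) (P : pred J) (F : J -> M) :
  rho s (\sum_(j | P j) F j) = \sum_(j | P j) rho s (F j).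
Proof. exact: (linear_sum (rhoL s)). Qed.

Lemma alg_act_linear a : linear (alg_act rho a).
Proof.
move=> k v w; rewrite /alg_act scaler_sumr -big_split /=; apply: eq_bigr => s _.
by rewrite rho_lin scalerDr !scalerA mulrC.
Qed.

Lemma alg_act0 a : alg_act rho a 0 = 0.
Proof. by rewrite /alg_act big1 // => s _; rewrite repr0 scaler0. Qed.

Lemma alg_actN a w : alg_act rho a (- w) = - alg_act rho a w.
Proof.
by rewrite /alg_act -sumrN; apply: eq_bigr => s _; rewrite reprN scalerN.
Qed.

Lemma alg_act_sum a (J : finType) (P : pred J) (F : J -> M) :
  alg_act rho a (\sum_(j | P j) F j) = \sum_(j | P j) alg_act rho a (F j).
Proof.
rewrite /alg_act exchange_big /=; apply: eq_bigr => s _.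
by rewrite repr_sum scaler_sumr.
Qed.

Lemma alg_actZ a k w : alg_act rho a (k *: w) = k *: alg_act rho a w.
Proof.
rewrite /alg_act scaler_sumr; apply: eq_bigr => s _.
by rewrite reprZ !scalerA mulrC.
Qed.

Lemma alg_act_suml (J : finType) (P : pred J) (F : J -> A) w :
  alg_act rho (\sum_(j | P j) F j) w = \sum_(j | P j) alg_act rho (F j) w.
Proof.
rewrite /alg_act exchange_big /=; apply: eq_bigr => s _.
by rewrite sum_ffunE scaler_suml.
Qed.

Lemma alg_actZl k a w : alg_act rho (k *: a) w = k *: alg_act rho a w.
Proof.
by rewrite /alg_act scaler_sumr; apply: eq_bigr => s _; rewrite ffunE scalerA.
Qed.

Lemma alg_act_delta s w : alg_act rho (alg_delta s) w = rho s w.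
Proof.
rewrite /alg_act (bigD1 s) //= ffunE eqxx scale1r big1 ?addr0 // => g /negPf ne.
by rewrite ffunE ne scale0r.
Qed.

Lemma alg_act_ltrans s a w : alg_act rho (ltrans s a) w = rho s (alg_act rho a w).
Proof.
rewrite /alg_act repr_sum (reindex_inj (mulgI s)) /=; apply: eq_bigr => g _.
by rewrite ffunE mulKg reprZ rhoM.
Qed.

Lemma alg_act_conv a b w :
  alg_act rho (conv a b) w = alg_act rho a (alg_act rho b w).
Proof.
rewrite {1}/alg_act /=.
rewrite [in RHS]/alg_act; under [RHS]eq_bigr do rewrite -alg_act_ltrans -alg_actZl.
by rewrite -alg_act_suml.
Qed.

(** Moves the conjugation from the coefficients to the operator, so that vanishing statements about
    Young symmetrizers pass to their class sums. *)
Lemma alg_act_class_sum a w :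
  alg_act rho (class_sum a) w = \sum_g rho g (alg_act rho a (rho g^-1%g w)).
Proof.
rewrite /alg_act; under eq_bigr do rewrite ffunE scaler_suml.
rewrite exchange_big /=; apply: eq_bigr => g _.
rewrite (reindex_inj (conjg_inj g^-1%g)) /= repr_sum; apply: eq_bigr => s _.
by rewrite conjgKV reprZ conjgE invgK !rhoM.
Qed.

Lemma alg_act_row lam w :
  alg_act rho (row_sym lam) w = \sum_(p in row_group n lam) rho p w.
Proof.
rewrite /alg_act [RHS]big_mkcond /=; apply: eq_bigr => s _.
by rewrite ffunE; case: ifP; rewrite ?scale1r ?scale0r.
Qed.

Lemma alg_act_col lam w :
  alg_act rho (col_sym lam) w =
  \sum_(q in col_group n lam) ((-1) ^+ odd_perm q : C) *: rho q w.
Proof.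
rewrite /alg_act [RHS]big_mkcond /=; apply: eq_bigr => s _.
by rewrite ffunE; case: ifP; rewrite ?mul1r ?mul0r ?scale0r.
Qed.

Lemma row_sym_absorbl lam p w : p \in row_group n lam ->
  rho p (alg_act rho (row_sym lam) w) = alg_act rho (row_sym lam) w.
Proof.
move=> p_row; rewrite !alg_act_row repr_sum.
rewrite [RHS](reindex_inj (mulgI p)) /=; apply: eq_big => [q|q _].
  by rewrite groupMl.
by rewrite rhoM.
Qed.

Lemma row_sym_absorbr lam p w : p \in row_group n lam ->
  alg_act rho (row_sym lam) (rho p w) = alg_act rho (row_sym lam) w.
Proof.
move=> p_row; rewrite !alg_act_row.
rewrite [RHS](reindex_inj (mulIg p)) /=; apply: eq_big => [q|q _].
  by rewrite groupMr.
by rewrite rhoM.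
Qed.

Lemma col_sym_absorbl lam q w : q \in col_group n lam ->
  rho q (alg_act rho (col_sym lam) w) =
  ((-1) ^+ odd_perm q : C) *: alg_act rho (col_sym lam) w.
Proof.
move=> q_col; rewrite !alg_act_col repr_sum scaler_sumr.
rewrite [RHS](reindex_inj (mulgI q)) /=; apply: eq_big => [p|p _].
  by rewrite groupMl.
by rewrite reprZ rhoM scalerA odd_permM signr_addb mulrA -expr2 sqrr_sign mul1r.
Qed.

Lemma col_sym_absorbr lam q w : q \in col_group n lam ->
  alg_act rho (col_sym lam) (rho q w) =
  ((-1) ^+ odd_perm q : C) *: alg_act rho (col_sym lam) w.
Proof.
move=> q_col; rewrite !alg_act_col scaler_sumr.
rewrite [RHS](reindex_inj (mulIg q)) /=; apply: eq_big => [p|p _].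
  by rewrite groupMr.
rewrite rhoM scalerA odd_permM signr_addb mulrCA -expr2 sqrr_sign.
by rewrite mulr1.
Qed.

Lemma eq_opp_eq0 (w : M) : w = - w -> w = 0.
Proof.
move/eqP; rewrite -addr_eq0 -mulr2n -scaler_nat scaler_eq0 pnatr_eq0 /=.
by move/eqP.
Qed.

(* A transposition that swaps two entries lying in a common row of one tableau
   and a common column of the other is absorbed with opposite signs. *)
Lemma row_col_sym_eq0 lam mu s w :
  sumn lam = n -> is_intpart n mu ->
  ~ (forall r, (sumn (take r lam) <= sumn (take r mu))%N) ->
  alg_act rho (row_sym lam) (rho s (alg_act rho (col_sym mu) w)) = 0 /\
  alg_act rho (col_sym mu) (rho s (alg_act rho (row_sym lam) w)) = 0.
Proof.
move=> lam_n mu_part ndom.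
have key (u : 'S_n) : exists i j : 'I_n, [/\ i != j,
    reshape_index lam i = reshape_index lam j &
    reshape_offset mu (u i) = reshape_offset mu (u j)].
  apply: contrapT => nex; apply: ndom; apply: (@dominated_of_separated _ _ _ u) => //.
  move=> i j ne_ij row_ij; apply/negP => /eqP col_ij; apply: nex.
  by exists i, j.
have tperm_stable (f : 'I_n -> nat) i j : f i = f j -> forall m, f (tperm i j m) = f m.
  by move=> fij m; case: tpermP => [->|->|] //.
split; apply: eq_opp_eq0.
- have [i [j [ne_ij row_ij col_ij]]] := key s.
  have row_t : tperm i j \in row_group n lam.
    by apply/row_groupP => m; apply: (tperm_stable (reshape_index lam)).
  have col_t : (tperm (s i) (s j)) \in col_group n mu.
    by apply/col_groupP => m; apply: (tperm_stable (reshape_offset mu)).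
  rewrite -{1}(row_sym_absorbr _ row_t) -alg_actN; congr (alg_act _ _ _).
  rewrite -rhoM; have -> : (tperm i j * s = s * tperm (s i) (s j))%g.
    by rewrite -tpermJ conjgC.
  rewrite rhoM (col_sym_absorbl _ col_t) odd_tperm (inj_eq perm_inj) ne_ij.
  by rewrite expr1 scaleN1r reprN.
(* Carried across [s] in this order, a transposition within a row of [lam] is conjugated by [s^-1]
   rather than by [s]. *)
- have [i [j [ne_ij row_ij col_ij]]] := key s^-1%g.
  have row_t : tperm i j \in row_group n lam.
    by apply/row_groupP => m; apply: (tperm_stable (reshape_index lam)).
  have col_t : (tperm (s^-1%g i) (s^-1%g j)) \in col_group n mu.
    by apply/col_groupP => m; apply: (tperm_stable (reshape_offset mu)).
  have := col_sym_absorbr (rho s (alg_act rho (row_sym lam) w)) col_t.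
  rewrite odd_tperm (inj_eq perm_inj) ne_ij expr1 scaleN1r => <-.
  rewrite -rhoM -tpermJ conjgE invgK -!mulgA mulVg mulg1 rhoM.
  by rewrite (row_sym_absorbl _ row_t).
Qed.

End Action.

Lemma conv_delta1 a : conv a (alg_delta 1) = a.
Proof.
apply/ffunP => g; rewrite sum_ffunE (bigD1 g) //= big1 => [|h ne_hg].
  by rewrite !ffunE mulVg eqxx addr0 [LHS]mulr1.
by rewrite !ffunE -eq_mulVg1 (negPf ne_hg) [LHS]mulr0.
Qed.

Lemma young_symmetrizerE lam :
  young_symmetrizer R n lam = conv (row_sym lam) (col_sym lam).
Proof.
apply/ffunP => g; rewrite ffunE alg_act_row sum_ffunE.
apply: eq_bigr => p p_row; rewrite !ffunE.
under eq_bigl => q do rewrite (can2_eq (mulKg p) (mulKVg p)) andbC.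
rewrite big_mkcondr /= (big_pred1_eq); case: ifP; by rewrite ?mul1r ?mul0r.
Qed.

(** A nonzero value would force each partition to dominate the other, by the two halves of
    [row_col_sym_eq0], and so all their partial sums to agree. *)
Lemma young_symmetrizer_orth (M : lmodType C) (rho : 'S_n -> M -> M) lam mu s w :
  is_repr rho -> is_intpart n lam -> is_intpart n mu -> lam != mu ->
  alg_act rho (young_symmetrizer R n lam)
    (rho s (alg_act rho (young_symmetrizer R n mu) w)) = 0.
Proof.
move=> rhoP lam_part mu_part; apply: contra_neq_eq => ne0.
have lam_n := sumn_intpart lam_part; have mu_n := sumn_intpart mu_part.
have dom1 r : (sumn (take r mu) <= sumn (take r lam))%N.
  move: r; apply: contrapT => ndom; case/eqP: ne0.
  rewrite !young_symmetrizerE !alg_act_conv //.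
  have [_ ->] :=
    row_col_sym_eq0 rhoP s (alg_act rho (col_sym mu) w) mu_n lam_part ndom.
  by rewrite alg_act0.
have dom2 r : (sumn (take r lam) <= sumn (take r mu))%N.
  move: r; apply: contrapT => ndom; case/eqP: ne0.
  rewrite !young_symmetrizerE !alg_act_conv //.
  (* The three middle factors [col_sym lam], [s], [row_sym mu] become one element of the group
     algebra. Expanded over permutations [g], it leaves [row_sym lam] and [col_sym mu] around each
     [g]. *)
  rewrite -(alg_act_ltrans rhoP s) -(alg_act_conv rhoP (col_sym lam)).
  rewrite [alg_act rho (alg_act _ _ _) _]/alg_act alg_act_sum // big1 // => g _.
  rewrite alg_actZ //.
  by have [-> _] := row_col_sym_eq0 rhoP g w lam_n mu_part ndom; rewrite scaler0.
apply: eq_from_sumn_take.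
- by case/and3P: lam_part.
- by case/and3P: mu_part.
- by move=> r; apply/eqP; rewrite eqn_leq dom1 dom2.
Qed.

End GroupAlgebra.

Lemma size_intpart n lam : is_intpart n lam -> (size lam <= n)%N.
Proof.
case/and3P => _ lam0 /eqP <-; elim: lam lam0 => //= x lam IH.
by rewrite inE negb_or => /andP[x0 /IH]; lia.
Qed.

Lemma nth_le_sumn (s : seq nat) i : (nth 0 s i <= sumn s)%N.
Proof. by elim: s i => [|x s IH] [|i] //=; [lia | have := IH i; lia]. Qed.

(** A partition of [n] has at most [n] parts, each at most [n], so the partitions form a finite type
    that can index sums and matrices. *)
Definition intpart (n : nat) : finType :=
  {b : n.-bseq 'I_n.+1 | is_intpart n [seq val i | i <- b]}.

Definition parts (n : nat) (P : intpart n) : seq nat := [seq val i | i <- val P].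

Lemma partsP n (P : intpart n) : is_intpart n (parts P).
Proof. exact: (valP P). Qed.

Lemma parts_inj n : injective (@parts n).
Proof.
by move=> P Q /(inj_map val_inj) eqPQ; apply/val_inj/val_inj.
Qed.

Lemma parts_surj n lam : is_intpart n lam -> exists P : intpart n, parts P = lam.
Proof.
move=> lam_part.
have size_b : (size [seq inord i : 'I_n.+1 | i <- lam] <= n)%N.
  by rewrite size_map size_intpart.
have valb : [seq val i | i <- Bseq size_b] = lam.
  rewrite /= -map_comp -[RHS]map_id; apply/eq_in_map => i /(nthP 0%N)[j _ <-].
  by rewrite /= inordK // ltnS -(sumn_intpart lam_part) nth_le_sumn.
have part_b : is_intpart n [seq val i | i <- Bseq size_b] by rewrite valb.
by exists (exist _ (Bseq size_b) part_b).
Qed.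

(** * Cycle types *)

(** The standard permutation with cycle lengths [sh]: positions are laid out in rows of these
    lengths, and each row is rotated by one step. *)
Definition cycle_next (sh : seq nat) (i : nat) : nat :=
  let r := reshape_index sh i in let c := reshape_offset sh i in
  flatten_index sh r (if c.+1 == nth 0 sh r then 0 else c.+1).

Lemma cycle_next_lt sh i : (i < sumn sh)%N -> (cycle_next sh i < sumn sh)%N.
Proof.
move=> lt_i; rewrite /cycle_next /=; apply: flatten_indexP.
have lt_c := reshape_offsetP lt_i; case: ifP => [_|/negbT ne].
  exact: leq_ltn_trans lt_c.
by rewrite ltn_neqAle ne lt_c.
Qed.

(** [L] lists the orbits of [s] by decreasing size, each one as x, s x, s (s x) and so on. *)
Lemma cycle_listing n (s : 'S_n) : exists sh : seq nat, exists2 L : seq 'I_n,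
  is_intpart n sh /\ perm_eq L (enum 'I_n) &
  forall x0 i, (i < n)%N -> s (nth x0 L i) = nth x0 L (cycle_next sh i).
Proof.
pose rs := sort (fun x y => geq (fingraph.order s x) (fingraph.order s y))
             [seq x <- enum 'I_n | froots s x].
pose Ls := [seq fingraph.orbit s x | x <- rs].
have shE : shape Ls = [seq fingraph.order s x | x <- rs].
  by rewrite /shape -map_comp; apply: eq_map => x /=; rewrite size_orbit.
have injs : injective s by apply: perm_inj.
have permL : perm_eq (flatten Ls) (enum 'I_n).
  apply/allP => y _ /=; rewrite (count_uniq_mem _ (enum_uniq _)) mem_enum /=.
  rewrite count_flatten -map_comp sumnE big_map.
  rewrite (perm_big _ (permEl (perm_sort _ _))) /= big_filter big_enum_cond /=.
  rewrite (bigD1 (froot s y)) /=; last exact: (roots_root (fconnect_sym injs)).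
  rewrite (count_uniq_mem _ (orbit_uniq _ _)) -fconnect_orbit.
  rewrite (fconnect_sym injs) connect_root big1 // => x /andP[rx ne_x].
  rewrite (count_uniq_mem _ (orbit_uniq _ _)) -fconnect_orbit.
  case: (boolP (fconnect s x y)) => // /(fingraph.rootP (fconnect_sym injs)).
  have /eqP -> : froot s x == x := rx.
  by move=> exy; rewrite exy eqxx in ne_x.
have sumL : sumn (shape Ls) = n.
  by rewrite -size_flatten (perm_size permL) size_enum_ord.
exists (shape Ls), (flatten Ls); first split=> //.
- rewrite /is_intpart sumL eqxx andbT shE; apply/andP; split.
    by rewrite sorted_map; apply: sort_sorted => x y; apply: leq_total.
  by apply/negP => /mapP[x _ e0]; have := fingraph.order_gt0 s x; rewrite -e0.
- move=> x0 i lt_i; have lt_i' : (i < sumn (shape Ls))%N by rewrite sumL.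
  set r := reshape_index (shape Ls) i; set c := reshape_offset (shape Ls) i.
  have lt_r : (r < size (shape Ls))%N by apply: reshape_indexP.
  have lt_r' : (r < size rs)%N by rewrite shE size_map in lt_r.
  have shr : nth 0%N (shape Ls) r = fingraph.order s (nth x0 rs r).
    by rewrite shE (nth_map x0).
  have lt_c : (c < fingraph.order s (nth x0 rs r))%N.
    by rewrite -shr; apply: reshape_offsetP.
  have nthL c' : (c' < fingraph.order s (nth x0 rs r))%N ->
      nth x0 (flatten Ls) (flatten_index (shape Ls) r c') = iter c' s (nth x0 rs r).
    move=> lt_c'; rewrite nth_flatten flatten_indexKl ?shr // flatten_indexKr ?shr //.
    rewrite (nth_map x0) // (set_nth_default (nth x0 rs r)) ?size_orbit //.
    by rewrite /fingraph.orbit nth_traject.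
  rewrite -{1}(reshape_indexK (shape Ls) i) nthL // /cycle_next -/r -/c shr.
  rewrite -iterS; case: eqP => [e|ne].
    by rewrite nthL ?fingraph.order_gt0 // e iter_order.
  by rewrite nthL //; lia.
Qed.

Definition cycle_type n (s : 'S_n) : seq nat := projT1 (cid (cycle_listing s)).

Lemma cycle_typeP n (s : 'S_n) : is_intpart n (cycle_type s).
Proof. by rewrite /cycle_type; case: cid => sh /= [L [? _] _]. Qed.

(** Matching the two cycle listings entry by entry yields the conjugating permutation. *)
Lemma cycle_type_conj n (s s' : 'S_n) : cycle_type s = cycle_type s' ->
  exists u : 'S_n, s' = (s ^ u)%g.
Proof.
rewrite /cycle_type; case: cid => sh /= [L [sh_part permL] nextL].
case: cid => sh' /= [L' [_ permL'] nextL'] e; rewrite -{sh'}e in nextL'.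
have szL : size L = n by rewrite (perm_size permL) size_enum_ord.
have szL' : size L' = n by rewrite (perm_size permL') size_enum_ord.
have uniqL : uniq L by rewrite (perm_uniq permL) enum_uniq.
have uniqL' : uniq L' by rewrite (perm_uniq permL') enum_uniq.
have memL x : x \in L by rewrite (perm_mem permL) mem_enum.
have idx_lt x : (index x L < n)%N by rewrite -[n in (_ < n)%N]szL index_mem.
pose f x := nth x L' (index x L).
have f_inj : injective f.
  move=> x y; rewrite /f (set_nth_default y) ?szL' // => /eqP.
  rewrite nth_uniq ?szL' // => /eqP exy.
  by rewrite -(nth_index x (memL x)) exy nth_index.
exists (perm f_inj); apply: (mulgI (perm f_inj)); rewrite -conjgC.
apply/permP => x; rewrite !permM !permE.
have sx : s x = nth x L (cycle_next sh (index x L)).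
  by rewrite -{1}(nth_index x (memL x)) nextL.
have lt_next : (cycle_next sh (index x L) < n)%N.
  rewrite -[n in (_ < n)%N](sumn_intpart sh_part) cycle_next_lt //.
  by rewrite (sumn_intpart sh_part).
rewrite /f sx index_uniq ?szL // nextL' //.
by apply: set_nth_default; rewrite szL'.
Qed.

(** * The isotypic decomposition of the group algebra *)

Section ClassFunctions.
Variables (R : realType) (n : nat).

Local Notation A := (cspace R 'S_n).
Local Notation C := (R[i]).
Local Notation conv := (alg_act (@ltrans R n)).

Definition young_class (lam : seq nat) : A := class_sum (young_symmetrizer R n lam).

Lemma young_class_conj lam g h : young_class lam (g ^ h)%g = young_class lam g.
Proof.
rewrite !ffunE [RHS](reindex_inj (mulgI h)) /=.
by apply: eq_bigr => u _; rewrite conjgM.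
Qed.

Lemma young_class_orth (M : lmodType C) (rho : 'S_n -> M -> M) lam mu w :
  is_repr rho -> is_intpart n lam -> is_intpart n mu -> lam != mu ->
  alg_act rho (young_class lam) (alg_act rho (young_class mu) w) = 0.
Proof.
move=> rhoP lam_part mu_part ne; have [_ _ rhoM] := rhoP.
rewrite !alg_act_class_sum // big1 // => g _.
rewrite repr_sum // alg_act_sum // repr_sum // big1 // => h _.
by rewrite -rhoM young_symmetrizer_orth // repr0.
Qed.

(** Here [q] lies in both groups, and a cell is determined by its row and its column. *)
Lemma row_col_group_disjoint lam (p q : 'S_n) : is_intpart n lam ->
  p \in row_group n lam -> q \in col_group n lam -> (p * q)%g = 1%g -> q = 1%g.
Proof.
move=> lam_part p_row q_col pq1.
have qE : q = p^-1%g by apply: (mulgI p); rewrite pq1 mulgV.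
have q_row : q \in row_group n lam by rewrite qE groupV.
apply/permP => i; rewrite perm1; apply: val_inj.
rewrite /= -(reshape_indexK lam (q i)).
by rewrite (row_groupP _ _ q_row) (col_groupP _ _ q_col) reshape_indexK.
Qed.

Lemma young_symmetrizer1 lam : is_intpart n lam ->
  young_symmetrizer R n lam 1%g = 1.
Proof.
move=> lam_part; rewrite ffunE (bigD1 1%g) ?group1 //=.
rewrite (bigD1 1%g) ?group1 ?mulg1 ?eqxx //= odd_perm1 expr0.
rewrite big1 => [|q /andP[/andP[_]]]; last by rewrite mul1g => ->.
rewrite addr0 big1 ?addr0 // => p /andP[p_row ne_p1].
rewrite big1 // => q /andP[q_col /eqP pq1].
have q1 := row_col_group_disjoint lam_part p_row q_col pq1.
by rewrite q1 mulg1 in pq1; rewrite pq1 eqxx in ne_p1.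
Qed.

Lemma young_class1 lam : is_intpart n lam -> young_class lam 1%g = (n`!)%:R.
Proof.
move=> lam_part; rewrite ffunE.
under eq_bigr do rewrite conj1g young_symmetrizer1 //.
by rewrite sumr_const card_Sn.
Qed.

Lemma young_class_real lam g : (young_class lam g : C) \is Num.real.
Proof.
rewrite ffunE rpred_sum // => u _; rewrite ffunE rpred_sum // => p _.
by rewrite rpred_sum // => q _; rewrite rpredX // rpredN rpred1.
Qed.

(** The inverse of [p * q] is conjugate to [p^-1 * q^-1], a product of the same kind with the same
    sign, and the class sum does not distinguish conjugates. *)
Lemma young_classV lam g : young_class lam g^-1%g = young_class lam g.
Proof.
rewrite !ffunE; under eq_bigr do rewrite ffunE pair_big_dep /=.
under [RHS]eq_bigr do rewrite ffunE pair_big_dep /=.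
pose F (u : 'S_n) (x : 'S_n * 'S_n) : C :=
  if [&& x.1 \in row_group n lam, x.2 \in col_group n lam & (x.1 * x.2)%g == u]
  then (-1) ^+ odd_perm x.2 else 0.
transitivity (\sum_u \sum_x F (g^-1 ^ u)%g x).
  by apply: eq_bigr => u _; rewrite [LHS]big_mkcond.
transitivity (\sum_u \sum_x F (g ^ u)%g x); last first.
  by apply: eq_bigr => u _; rewrite [RHS]big_mkcond.
rewrite exchange_big [RHS]exchange_big /=.
rewrite [LHS](reindex_inj
  (h := fun x : 'S_n * 'S_n => (x.1^-1, x.2^-1)%g)) /=; last first.
  by move=> [a b] [c d] /= [/invg_inj -> /invg_inj ->].
apply: eq_bigr => -[p q] _.
rewrite [RHS](reindex_inj (mulIg q)) /=; apply: eq_bigr => u _.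
rewrite /F /= !groupV odd_permV; congr (if [&& _, _ & _] then _ else _).
rewrite conjgM conjVg -invMg (inj_eq invg_inj).
rewrite [X in _ = (_ == X)]conjgE; apply/eqP/eqP => [<-|e].
  by rewrite !mulgA mulVg mul1g.
by apply: (mulIg q); rewrite -mulgA e mulKVg.
Qed.

(** By [young_classV] the coefficient at the unit is a sum of squares of real numbers, one of which
    is the square of n!. *)
Lemma young_class_sq lam : is_intpart n lam ->
  conv (young_class lam) (young_class lam) 1%g != 0.
Proof.
move=> lam_part; rewrite sum_ffunE.
have -> : \sum_i ((young_class lam i : C) *: ltrans i (young_class lam)) 1%g =
          \sum_i (young_class lam i : C) ^+ 2.
  by apply: eq_bigr => i _; rewrite ffunE [ltrans _ _ _]ffunE mulg1 young_classV.
apply/lt0r_neq0; rewrite (bigD1 1%g) //=; apply: ltr_wpDr.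
  by apply: sumr_ge0 => g _; rewrite real_exprn_even_ge0 ?young_class_real.
by rewrite young_class1 // exprn_gt0 // ltr0n fact_gt0.
Qed.

(** Multiplying the relation by one [young_class] kills all other terms, and its own square is
    nonzero. *)
Lemma young_class_free (al : intpart n -> C) :
  \sum_P al P *: young_class (parts P) = 0 -> forall P, al P = 0.
Proof.
move=> sum0 P; have lr := ltrans_repr R n.
have := congr1 (conv (young_class (parts P))) sum0.
rewrite alg_act0 // alg_act_sum // (bigD1 P) //= big1 => [|Q ne_QP]; last first.
  rewrite alg_actZ // -[young_class (parts Q)]conv_delta1.
  rewrite young_class_orth ?scaler0 ?partsP //.
  by rewrite eq_sym (inj_eq (@parts_inj n)).
rewrite addr0 alg_actZ // => /(congr1 (fun a : A => a 1%g)); rewrite !ffunE.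
move/eqP; rewrite mulf_eq0 (negPf (young_class_sq (partsP P))) orbF.
by move/eqP.
Qed.

(* There are at least as many independent class functions [young_class lam] as
   cycle types, so they span all class functions, in particular the unit. *)
Lemma young_class_unit : exists al : intpart n -> C,
  alg_delta R 1%g = \sum_P al P *: young_class (parts P).
Proof.
pose N := #|intpart n|.
(* [psi] samples a function at one permutation of each cycle type, with value 0 if there is none. It
   is injective on class functions because permutations of equal cycle type are conjugate. *)
pose psi (f : A) : 'rV[C]_N :=
  \row_j (if [pick g | cycle_type g == parts (enum_val j)] is Some g then f g else 0).
have psi_sum (J : finType) (c : J -> C) (F : J -> A) :
    psi (\sum_j c j *: F j) = \sum_j c j *: psi (F j).
  apply/rowP => j; rewrite summxE mxE; under [RHS]eq_bigr do rewrite !mxE.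
  case: pickP => [g _|_]; last by rewrite big1 // => i _; rewrite mulr0.
  by rewrite sum_ffunE; apply: eq_bigr => i _; rewrite ffunE.
have psi_inj (f f' : A) : (forall g h, f (g ^ h)%g = f g) ->
    (forall g h, f' (g ^ h)%g = f' g) -> psi f = psi f' -> f = f'.
  move=> class_f class_f' eq_psi; apply/ffunP => g.
  have [P partsE] := parts_surj (cycle_typeP g).
  have /rowP/(_ (enum_rank P)) := eq_psi; rewrite !mxE enum_rankK.
  case: pickP => [h /eqP|/(_ g)]; last by rewrite partsE eqxx.
  by rewrite partsE => /cycle_type_conj[u ->]; rewrite class_f class_f'.
pose M : 'M[C]_N := \matrix_i psi (young_class (parts (enum_val i))).
have mulM (u : 'rV[C]_N) :
    u *m M = psi (\sum_P u 0 (enum_rank P) *: young_class (parts P)).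
  rewrite psi_sum mulmx_sum_row [RHS](reindex _ (onW_bij _ (enum_val_bij _))) /=.
  by apply: eq_bigr => i _; rewrite rowK enum_valK.
have class_sumP (al : intpart n -> C) g h :
    (\sum_P al P *: young_class (parts P)) (g ^ h)%g =
    (\sum_P al P *: young_class (parts P)) g.
  rewrite !sum_ffunE; apply: eq_bigr => P _.
  by rewrite [LHS]ffunE [RHS]ffunE young_class_conj.
(* Rows and columns of [M] are both indexed by the partitions of [n], so the independence in
   [young_class_free] makes it invertible. *)
have Munit : M \in unitmx.
  rewrite -row_free_unit; apply: inj_row_free => u; rewrite mulM => psi0.
  apply/rowP => i; rewrite mxE -(enum_valK i).
  apply: (@young_class_free (fun P => u 0 (enum_rank P))).
  apply: psi_inj; [exact: class_sumP | by move=> g h; rewrite !ffunE |].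
  by rewrite psi0; apply/rowP => j; rewrite !mxE; case: pickP => // g _; rewrite ffunE.
exists (fun P => (psi (alg_delta R 1%g) *m invmx M) 0 (enum_rank P)).
apply: psi_inj; [|exact: class_sumP|by rewrite -mulM mulmxKV].
by move=> g h; rewrite !ffunE -{1}(conj1g h) (inj_eq (conjg_inj h)).
Qed.

End ClassFunctions.

Section Idempotents.
Variables (R : realType) (n : nat).

Local Notation A := (cspace R 'S_n).
Local Notation C := (R[i]).
Local Notation conv := (alg_act (@ltrans R n)).

(** The term of shape [P] in the chosen expansion of the unit. Orthogonality of the terms makes
    these central elements idempotent. *)
Definition young_idem (P : intpart n) : A :=
  projT1 (cid (young_class_unit R n)) P *: young_class R n (parts P).

Lemma sum_young_idem : \sum_P young_idem P = alg_delta R 1%g.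
Proof. by rewrite /young_idem; case: cid => al /= ->. Qed.

Section Action.
Variables (M : lmodType C) (rho : 'S_n -> M -> M).
Hypothesis rhoP : is_repr rho.

Definition alg_lin a : {linear M -> M} :=
  HB.pack (alg_act rho a)
    (GRing.isLinear.Build C M M *:%R (alg_act rho a) (alg_act_linear rhoP a)).

Lemma alg_act_linearl w : linear (fun a : A => alg_act rho a w).
Proof.
move=> k a b; rewrite /alg_act scaler_sumr -big_split /=; apply: eq_bigr => s _.
by rewrite !ffunE scalerDl scalerA.
Qed.

(** The orbit map of [w] on the regular representation. Such maps supply the equivariant maps out of
    the Specht modules in [isotypicE]. *)
Definition alg_linl w : {linear A -> M} :=
  HB.pack (fun a : A => alg_act rho a w)
    (GRing.isLinear.Build C A M *:%R (fun a : A => alg_act rho a w)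
       (alg_act_linearl w)).

Lemma young_idem_sum w : \sum_P alg_act rho (young_idem P) w = w.
Proof.
by rewrite -alg_act_suml sum_young_idem alg_act_delta; case: rhoP => _ -> _.
Qed.

Lemma young_idem_orth P Q w : P != Q ->
  alg_act rho (young_idem P) (alg_act rho (young_idem Q) w) = 0.
Proof.
move=> ne; rewrite !alg_actZl alg_actZ // young_class_orth ?partsP ?scaler0 //.
by rewrite (inj_eq (@parts_inj n)).
Qed.

Lemma young_idem_idem P w :
  alg_act rho (young_idem P) (alg_act rho (young_idem P) w) =
  alg_act rho (young_idem P) w.
Proof.
rewrite -{2}(young_idem_sum w) alg_act_sum // (bigD1 P) //= big1 ?addr0 // => Q ne.
by rewrite young_idem_orth // eq_sym.
Qed.

Lemma young_idem_symmetrizer_orth P Q s w : P != Q ->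
  alg_act rho (young_idem P)
    (rho s (alg_act rho (young_symmetrizer R n (parts Q)) w)) = 0.
Proof.
move=> ne; have [_ _ rhoM] := rhoP.
rewrite alg_actZl alg_act_class_sum // big1 ?scaler0 // => g _.
rewrite -rhoM young_symmetrizer_orth ?partsP ?repr0 //.
by rewrite (inj_eq (@parts_inj n)).
Qed.

Lemma young_idemE P w : exists k : C, alg_act rho (young_idem P) w =
  k *: \sum_g rho g (alg_act rho (young_symmetrizer R n (parts P)) (rho g^-1%g w)).
Proof. by eexists; rewrite alg_actZl alg_act_class_sum. Qed.

End Action.

(** The other idempotents kill every generator of the Specht module, and all of them together sum to
    the identity. *)
Lemma young_idem_specht P x : x \in specht R n (parts P) -> conv (young_idem P) x = x.
Proof.
have lr := ltrans_repr R n; pose E := linfun (alg_lin lr (young_idem P)).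
move=> x_sp; suff /fixedSpaceP : x \in fixedSpace E by rewrite lfunE.
move: x x_sp; apply/subvP/span_subvP => x /mapP[s _ ->]; apply/fixedSpaceP.
rewrite lfunE /= -[RHS](young_idem_sum lr) (bigD1 P) //= big1 ?addr0 // => Q ne.
rewrite -[young_symmetrizer R n (parts P)]conv_delta1.
by rewrite (young_idem_symmetrizer_orth lr).
Qed.

End Idempotents.

(** * Isotypic components of tensor powers *)

Section Isotypic.
Variables (R : realType) (n : nat) (X : finType).

Local Notation A := (cspace R 'S_n).
Local Notation C := (R[i]).
Local Notation W := (cspace R {ffun 'I_n -> X}).
Local Notation rho := (@perm_act R n X).
Let rhoP := @perm_act_repr R n X.
Let E (P : intpart n) : 'End(W) := linfun (alg_lin rhoP (young_idem R P)).

Lemma span_ofE (B : W -> Prop) (U : {vspace W}) :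
  (forall w, B w -> w \in U) ->
  (forall U' : {vspace W}, (forall w, B w -> w \in U') -> (U <= U')%VS) ->
  span_of B = U.
Proof.
move=> BU Umin; rewrite /span_of; case: xgetP => [V _ [BV Vmin]|/(_ U)[]] //.
by apply/eqP; rewrite eqEsubv Vmin ?Umin.
Qed.

(** An equivariant map commutes with the idempotent, which fixes the Specht module. Conversely, the
    idempotent maps [v] to a combination of translates of Young symmetrizer images, each of which
    lies in the image of an orbit map. *)
Lemma isotypicE P : isotypic R n X (parts P) = limg (E P).
Proof.
apply: span_ofE => [w [f f_eq /memv_imgP[x x_sp ->]]|U' genU'].
  have -> : f x = E P (f x).
    rewrite lfunE /= -{1}(young_idem_specht x_sp) linear_sum; apply: eq_bigr => s _.
    by rewrite linearZ /= f_eq.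
  exact/memv_img/memvf.
apply/subvP => w /memv_imgP[v _ ->]; rewrite lfunE /=.
have [k ->] := young_idemE rhoP P v; apply/memvZ/memv_suml => g _.
apply: genU'; exists (linfun (alg_linl rho (rho g^-1%g v))).
  by move=> s a _; rewrite !lfunE /= alg_act_ltrans.
have -> : rho g (alg_act rho (young_symmetrizer R n (parts P)) (rho g^-1%g v)) =
    linfun (alg_linl rho (rho g^-1%g v)) (ltrans g (young_symmetrizer R n (parts P))).
  by rewrite lfunE /= alg_act_ltrans.
by apply/memv_img/memv_span/map_f; rewrite mem_enum.
Qed.

(** The other components span the kernel of the idempotent, so projecting along them is applying the
    idempotent. *)
Lemma isotypic_projE P w :
  isotypic_proj R n X (parts P) w = alg_act rho (young_idem R P) w.
Proof.
rewrite /isotypic_proj isotypicE.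
have -> : span_of (fun w : W => exists mu : seq nat,
       [/\ is_intpart n mu, mu != parts P & w \in isotypic R n X mu]) = lker (E P).
  apply: span_ofE => [v [mu [mu_part ne]]|U' genU'].
    have [Q QE] := parts_surj mu_part; rewrite -QE isotypicE => /memv_imgP[u _ ->].
    rewrite memv_ker !lfunE /= young_idem_orth //.
    by apply: contra ne => /eqP ->; rewrite QE.
  apply/subvP => v; rewrite memv_ker lfunE /= => /eqP v0.
  rewrite -(young_idem_sum rhoP v) (bigD1 P) //= v0 add0r; apply: memv_suml => Q ne.
  apply: genU'; exists (parts Q); split; first exact: partsP.
    by rewrite (inj_eq (@parts_inj n)).
  rewrite isotypicE; have -> : alg_act rho (young_idem R Q) v = E Q v by rewrite lfunE.
  exact/memv_img/memvf.
have EE v : E P (E P v) = E P v by rewrite !lfunE /= young_idem_idem.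
have cap0 : (limg (E P) :&: lker (E P) = 0)%VS.
  apply/eqP; rewrite -subv0; apply/subvP => v; rewrite memv_cap => /andP[].
  case/memv_imgP => u _ ->; rewrite memv_ker EE => /eqP ->; exact: mem0v.
have kerE : w - E P w \in lker (E P) by rewrite memv_ker linearB /= EE subrr.
have imE : E P w \in limg (E P) by exact/memv_img/memvf.
transitivity (E P w); last by rewrite lfunE.
rewrite -{1}(subrK (E P w) w) linearD /= (daddv_pi_id cap0 imE).
have := daddv_pi_add cap0 (subvP (addvSr _ _) _ kerE).
rewrite (@daddv_pi_id _ _ (lker _)) 1?capvC // => /(canRL (addrK _)) ->.
by rewrite subrr add0r.
Qed.

Lemma isotypic_proj_sum (w : W) :
  \sum_(P : intpart n) isotypic_proj R n X (parts P) w = w.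
Proof.
rewrite -[RHS](young_idem_sum rhoP).
by apply: eq_bigr => P _; rewrite isotypic_projE.
Qed.

Lemma isotypic_proj_perm_act (P : intpart n) s (w : W) :
  isotypic_proj R n X (parts P) (perm_act s w) =
  perm_act s (isotypic_proj R n X (parts P) w).
Proof.
rewrite !isotypic_projE !alg_actZl (reprZ rhoP) /alg_act (repr_sum rhoP).
congr (_ *: _); rewrite (reindex_inj (conjg_inj s^-1%g)) /=; apply: eq_bigr => g _.
have [_ _ rhoM] := rhoP.
by rewrite (reprZ rhoP) young_class_conj -!rhoM conjgE invgK -!mulgA mulVg mulg1.
Qed.

(** By the pigeonhole principle two cells of the first column carry the same letter of [x]. Their
    transposition fixes [x] but reverses the sign of the value there. *)
Lemma col_sym_eq0 lam (w : W) : is_intpart n lam -> (#|X| < size lam)%N ->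
  alg_act rho (col_sym R n lam) w = 0.
Proof.
move=> lam_part lt_X; apply/ffunP => x; rewrite [RHS]ffunE.
have valid (r : 'I_(size lam)) : (0 < nth 0 lam r)%N.
  have /and3P[_ lam0 _] := lam_part.
  by rewrite lt0n; apply: contra lam0 => /eqP <-; rewrite mem_nth.
have lt_n (r : 'I_(size lam)) : (flatten_index lam r 0 < n)%N.
  by have := flatten_indexP (valid r); rewrite (sumn_intpart lam_part).
pose cell r := Ordinal (lt_n r).
have : ~ injective (fun r => x (cell r)).
  by move=> /leq_card; rewrite card_ord leqNgt lt_X.
move=> /existsNP[r /existsNP[r' /not_implyP[xrr' ne_rr']]].
have ne_cell : cell r != cell r'.
  apply/eqP => /(congr1 (fun i : 'I_n => reshape_index lam i)) /=.
  by rewrite !flatten_indexKl // => /val_inj.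
have t_col : tperm (cell r) (cell r') \in col_group n lam.
  by apply/col_groupP => m; case: tpermP => [->|->|] //=; rewrite !flatten_indexKr.
have := col_sym_absorbl rhoP w t_col; set v := alg_act _ _ w.
move=> /(congr1 (fun u : W => u x)); rewrite odd_tperm ne_cell expr1 scaleN1r.
rewrite !ffunE (_ : [ffun m => _] = x); last first.
  by apply/ffunP => m; rewrite ffunE tpermV; case: tpermP => [->|->|] //=.
by move/(@eq_opp_eq0 R (R[i])^o).
Qed.

End Isotypic.

(** * Dimension of the isotypic components *)

Lemma sum_reshape_index (V : zmodType) (sh : seq nat) (F : nat -> V) :
  \sum_(i < sumn sh) F (reshape_index sh i) = \sum_(r < size sh) F r *+ nth 0%N sh r.
Proof.
elim: sh F => [|m sh IH] F; first by rewrite !big_ord0.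
rewrite [sumn _]/= big_split_ord big_ord_recl; congr (_ + _).
  rewrite -[m in _ *+ nth _ (m :: _) _]card_ord -sumr_const.
  by apply: eq_bigr => i _; rewrite reshape_index_cons /= ltn_ord.
rewrite -(IH (fun r => F r.+1)); apply: eq_bigr => i _.
by rewrite reshape_index_cons /= ltnNge leq_addr /= addKn.
Qed.

Section Words.
Variables (n : nat) (lam : seq nat).
Hypothesis lam_part : is_intpart n lam.

Lemma row_lt (i : 'I_n) : (reshape_index lam i < size lam)%N.
Proof. by apply: reshape_indexP; rewrite (sumn_intpart lam_part). Qed.

(** As [s] varies these are the words of content [lam]. The stabilizer of such a word is a conjugate
    of the row group. *)
Definition row_word (s : 'S_n) : {ffun 'I_n -> 'I_(size lam)} :=
  [ffun m => Ordinal (row_lt (s m))].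

Definition row_words : {set {ffun 'I_n -> 'I_(size lam)}} :=
  [set row_word s | s : 'S_n].

(* Each word of content lam has probability 2 ^ (- n H(lam / n)) under the
   n-fold product of the distribution lam / n. *)
Lemma card_row_words (R : realType) : (0 < n)%N ->
  (#|row_words|%:R : R) <= 2 `^ (n%:R * entropy R n lam).
Proof.
move=> n_gt0; have lam_n := sumn_intpart lam_part.
have n_neq0 : (n%:R : R) != 0 by rewrite pnatr_eq0 -lt0n.
pose p (r : nat) : R := (nth 0%N lam r)%:R / n%:R.
have p_ge0 r : 0 <= p r by rewrite divr_ge0.
have p_gt0 (i : 'I_n) : 0 < p (reshape_index lam i).
  have := reshape_offsetP (_ : (i < sumn lam)%N); rewrite lam_n => /(_ (ltn_ord i)) lt_o.
  by rewrite divr_gt0 // ltr0n //; apply: leq_ltn_trans lt_o.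
pose q := \prod_(m < n) p (reshape_index lam m).
have q_gt0 : 0 < q by rewrite prodr_gt0.
have sum_p : \sum_(r < size lam) p r = 1.
  have sum_lam : (\sum_(r < size lam) nth 0 lam r)%N = n.
    by rewrite -[RHS]lam_n sumnE [RHS](big_nth 0%N) big_mkord.
  by rewrite -mulr_suml -natr_sum sum_lam divff.
have : #|row_words|%:R * q <= 1.
  have sum1 : \sum_(f : {ffun 'I_n -> 'I_(size lam)}) \prod_m p (f m) = 1.
    rewrite -(bigA_distr_bigA (fun (_ : 'I_n) (r : 'I_(size lam)) => p r)).
    by rewrite sum_p big1.
  rewrite -[leRHS]sum1 (bigID (mem row_words)) /= -[leLHS]addr0 lerD //; last first.
    by apply: sumr_ge0 => f _; apply: prodr_ge0.
  rewrite mulr_natl -sumr_const; apply: ler_sum => _ /imsetP[s _ ->].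
  rewrite /q (reindex_inj (@perm_inj _ s)) /=.
  by under [leRHS]eq_bigr do rewrite ffunE.
rewrite -ler_pdivlMr // div1r => /le_trans; apply.
suff -> : q^-1 = 2 `^ (n%:R * entropy R n lam) by [].
have -> : q = expR (\sum_(m < n) ln (p (reshape_index lam m))).
  by rewrite expR_sum; apply: eq_bigr => m _; rewrite lnK ?posrE ?p_gt0.
rewrite /powR gt_eqF ?ltr0n // -expRN; congr expR.
transitivity (- \sum_(r < size lam) ln (p r) *+ nth 0%N lam r).
  by congr (- _); rewrite -(sum_reshape_index lam (fun r => ln (p r))) lam_n.
have ln2 : ln 2 != 0 :> R by rewrite gt_eqF // ln_gt0 // ltr1n.
rewrite /entropy mulrN mulNr; congr (- _).
rewrite (big_nth 0%N) big_mkord mulr_sumr mulr_suml; apply: eq_bigr => r _.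
have np : n%:R * p r = (nth 0%N lam r)%:R by rewrite mulrC divfK.
by rewrite -/(p r) mulrA np -mulrA divfK // mulr_natl.
Qed.

End Words.

Section Dimension.
Variables (R : realType) (n : nat) (X : finType).

Local Notation C := (R[i]).
Local Notation W := (cspace R {ffun 'I_n -> X}).
Local Notation rho := (@perm_act R n X).
Let rhoP := @perm_act_repr R n X.

(** The indicator of the words [y] whose joint letter counts with [f] are [N]. Such words form one
    orbit, possibly empty, of the stabilizer of [f]. *)
Definition stat_indicator (J : finType) (f : {ffun 'I_n -> J})
    (N : {ffun J * X -> 'I_n.+1}) : W :=
  [ffun y : {ffun 'I_n -> X} =>
    [forall z, #|[set m | (f m, y m) == z]| == N z]%:R].

Lemma same_stat_perm (J : finType) (f : {ffun 'I_n -> J}) (y y' : {ffun 'I_n -> X}) :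
  (forall z, #|[set m | (f m, y m) == z]| = #|[set m | (f m, y' m) == z]|) ->
  exists s : 'S_n, forall m, f (s m) = f m /\ y (s m) = y' m.
Proof.
move=> stat; pose t := [tuple (f m, y m) | m < n]; pose t' := [tuple (f m, y' m) | m < n].
have cnt (u : {ffun 'I_n -> X}) z :
    count_mem z [tuple (f m, u m) | m < n] = #|[set m | (f m, u m) == z]|.
  rewrite /= count_map -sum1_count big_enum_cond cardsE -sum1_card.
  exact: eq_bigl.
have /tuple_permP[s E] : perm_eq t' t.
  by apply/allP => z _; rewrite /= !cnt stat.
exists s => m; have := congr1 (fun l => nth (f m, y m) l m) E.
have e1 : nth (f m, y m) t' m = (f m, y' m) by rewrite -tnth_nth tnth_mktuple.
rewrite e1 -[X in _ = nth _ X _]/(val [tuple tnth t (s i) | i < n]).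
by rewrite -tnth_nth !tnth_mktuple => -[-> ->].
Qed.

(** An invariant [w] is constant on the orbits of the stabilizer of [f]. The coefficient is its
    value at a representative, or 0 for an empty orbit. *)
Lemma invariant_span (J : finType) (f : {ffun 'I_n -> J}) (w : W) :
  (forall s : 'S_n, (forall m, f (s m) = f m) -> perm_act s w = w) ->
  w = \sum_N (odflt 0 (omap w [pick y | stat_indicator f N y != 0]) : C) *:
        stat_indicator f N.
Proof.
move=> w_inv; apply/ffunP => y; rewrite sum_ffunE.
have card_lt z : (#|[set m | (f m, y m) == z]| < n.+1)%N.
  by rewrite ltnS -[leqRHS]card_ord max_card.
pose Ny : {ffun J * X -> 'I_n.+1} := [ffun z => Ordinal (card_lt z)].
have indNy : stat_indicator f Ny y = 1.
  by rewrite ffunE; case: forallP => // -[] z; rewrite ffunE.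
rewrite (bigD1 Ny) //= big1 ?addr0 => [|N ne_N]; last first.
  rewrite ffunE [stat_indicator _ _ _]ffunE; case: forallP => [statN|]; last first.
    by rewrite [LHS]mulr0.
  case/eqP: ne_N; apply/ffunP => z; apply: val_inj; rewrite ffunE /=.
  by rewrite (eqP (statN z)).
rewrite ffunE indNy [RHS]mulr1; case: pickP => [y'|/(_ y)]; last first.
  by rewrite indNy oner_eq0.
rewrite ffunE; case: forallP => [statN _|]; last by rewrite eqxx.
have [|s sP] := @same_stat_perm _ f y y'.
  by move=> z; rewrite (eqP (statN z)) ffunE.
have inv_s : perm_act s^-1%g w = w.
  by apply: w_inv => m; have [<- _] := sP (s^-1%g m); rewrite permKV.
rewrite -{1}inv_s [LHS]ffunE /=; congr (w _); apply/ffunP => m.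
by rewrite ffunE invgK; have [_ ->] := sP m.
Qed.

Lemma isotypic_proj_eq0 lam (w : W) : is_intpart n lam -> (#|X| < size lam)%N ->
  isotypic_proj R n X lam w = 0.
Proof.
move=> lam_part lt_X; have [P PE] := parts_surj lam_part.
rewrite -PE isotypic_projE; have [k ->] := young_idemE rhoP P w.
rewrite big1 ?scaler0 // => g _; rewrite young_symmetrizerE alg_act_conv //.
by rewrite PE col_sym_eq0 // alg_act0 // repr0.
Qed.

(** The image is spanned by vectors [rho g (row_sym w')], each invariant under the stabilizer of the
    row word of [g]. Hence one indicator for each word of content [lam] and each joint count
    suffices. *)
Lemma isotypic_proj_rank lam : (0 < n)%N -> is_intpart n lam ->
  exists (r : nat) (v : 'I_r -> W) (c : 'I_r -> W -> C),
    (r%:R : R) <= (n.+1 ^ (#|X| * #|X|))%:R * 2 `^ (n%:R * entropy R n lam) /\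
    forall w, isotypic_proj R n X lam w = \sum_i c i w *: v i.
Proof.
move=> n_gt0 lam_part; have [P PE] := parts_surj lam_part.
(* With more than [#|X|] parts the projection vanishes; otherwise there are at most [#|X| * #|X|]
   pairs of letters to count. *)
have [lt_X|le_X] := ltnP #|X| (size lam).
  exists 0%N, (fun _ => 0), (fun _ _ => 0); split.
    by rewrite mulr_ge0 ?powR_ge0.
  by move=> w; rewrite big_ord0 isotypic_proj_eq0.
pose J := [set: {ffun 'I_(size lam) * X -> 'I_n.+1}].
pose vs := [seq stat_indicator fN.1 fN.2 |
             fN <- enum (finset.setX (row_words lam_part) J)].
pose U := <<vs>>%VS.
have inU w : isotypic_proj R n X lam w \in U.
  rewrite -PE isotypic_projE; have [k ->] := young_idemE rhoP P w.
  apply/memvZ/memv_suml => g _; rewrite young_symmetrizerE alg_act_conv //.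
  set w' := alg_act _ _ (rho _ _).
  rewrite [X in X \in _](@invariant_span _ (row_word lam_part g)); last first.
    move=> s sP; have [_ _ rhoM] := rhoP.
    have -> : perm_act s (rho g (alg_act rho (row_sym R n (parts P)) w')) =
       rho g (rho (s ^ g)%g (alg_act rho (row_sym R n (parts P)) w')).
      by rewrite -!rhoM conjgC.
    rewrite (row_sym_absorbl rhoP) // PE; apply/row_groupP => m.
    have /(congr1 val) := sP (g^-1%g m); rewrite !ffunE /= permKV => row_eq.
    by rewrite conjgE !permM row_eq.
  apply: memv_suml => N _; apply/memvZ/memv_span/mapP.
  exists (row_word lam_part g, N) => //.
  by rewrite mem_enum inE /= !inE andbT imset_f.
exists (\dim U), (fun i => (vbasis U)`_i).
exists (fun i w => coord (vbasis U) i (isotypic_proj R n X lam w)).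
split; last by move=> w; rewrite -coord_vbasis.
have : (\dim U <= #|row_words lam_part| * n.+1 ^ (#|X| * #|X|))%N.
  apply: leq_trans (dim_span _) _; rewrite size_map -cardE cardsX leq_mul2l.
  rewrite cardsT card_ffun card_prod !card_ord leq_exp2l // leq_mul2r le_X.
  by rewrite !orbT.
rewrite -(ler_nat R) => /le_trans; apply; rewrite natrM mulrC ler_wpM2l //.
exact: card_row_words.
Qed.

End Dimension.

(** * Sums of slices *)

Lemma eq_foldl_in (T : eqType) (U : Type) (f g : U -> T -> U) (u : U) (s : seq T) :
  (forall x v, x \in s -> f v x = g v x) -> foldl f u s = foldl g u s.
Proof.
elim: s u => //= x s IH u fg; rewrite fg ?mem_head //; apply: IH => y v ys.
by rewrite fg // inE ys orbT.
Qed.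

(** Such a partition is determined by its first [d] entries, padded with zeros. *)
Lemma card_short_intpart n d :
  (#|[set P : intpart n | size (parts P) <= d]%N| <= n.+1 ^ d)%N.
Proof.
pose F (P : intpart n) : {ffun 'I_d -> 'I_n.+1} :=
  [ffun i : 'I_d => inord (nth 0%N (parts P) i)].
have F_inj : {in [set P : intpart n | size (parts P) <= d]%N &, injective F}.
  have nth_lt (P : intpart n) i : (nth 0 (parts P) i < n.+1)%N.
    by rewrite ltnS -[leqRHS](sumn_intpart (partsP P)) nth_le_sumn.
  move=> P Q; rewrite !inE => szP szQ eqF; apply: parts_inj.
  have eq_nth i : nth 0%N (parts P) i = nth 0%N (parts Q) i.
    have [lt_i|le_i] := ltnP i d; last first.
      by rewrite !nth_default //; [exact: leq_trans le_i | exact: leq_trans le_i].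
    have /ffunP/(_ (Ordinal lt_i)) := eqF; rewrite !ffunE => /(congr1 val).
    by rewrite /= !inordK.
  apply: eq_from_sumn_take => [||r]; try by case/and3P: (partsP P) (partsP Q).
    by case/and3P: (partsP Q).
  have sum_takeE (s : seq nat) : sumn (take r s) = (\sum_(i < r) nth 0 s i)%N.
    elim: s r => [|x s IH] [|r] //=; rewrite ?big_ord0 //.
      by rewrite big1 // => i _; rewrite nth_nil.
    by rewrite big_ord_recl /= IH.
  by rewrite !sum_takeE; apply: eq_bigr.
rewrite -(card_in_imset F_inj); apply: leq_trans (max_card _) _.
by rewrite card_ffun !card_ord.
Qed.

Section SumsOf.
Variables (R : realType) (k : nat) (I : 'I_k -> finType).
Variable Q : tensor R I -> Prop.

(** The bound is a real number because the estimates involve 2^(nc). *)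
Definition sum_of_at_most (t : tensor R I) (x : R) : Prop :=
  exists2 r, is_sum_of Q t r & r%:R <= x.

Lemma sum_of_at_most0 x : 0 <= x -> sum_of_at_most 0 x.
Proof. by exists 0%N => //; exists (fun _ => 0) => [[]|]; rewrite ?big_ord0. Qed.

Lemma sum_of_at_mostD t1 t2 x1 x2 :
  sum_of_at_most t1 x1 -> sum_of_at_most t2 x2 -> sum_of_at_most (t1 + t2) (x1 + x2).
Proof.
case=> r1 [s1 Qs1 ->] le1 [r2 [s2 Qs2 ->] le2].
exists (r1 + r2)%N; last by rewrite natrD lerD.
exists (fun i => match fintype.split i with inl j => s1 j | inr j => s2 j end).
  by move=> i; case: (fintype.split i).
rewrite big_split_ord; congr (_ + _); apply: eq_bigr => i _.
  by rewrite -[lshift _ _]/(unsplit (inl i)) unsplitK.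
by rewrite -[rshift _ _]/(unsplit (inr i)) unsplitK.
Qed.

Lemma sum_of_at_most_sum (J : finType) (t : J -> tensor R I) (x : J -> R) :
  (forall j, sum_of_at_most (t j) (x j)) ->
  sum_of_at_most (\sum_j t j) (\sum_j x j).
Proof.
move=> tx; apply: (big_ind2 sum_of_at_most) => //; first exact: sum_of_at_most0.
by move=> *; apply: sum_of_at_mostD.
Qed.

Lemma sum_of_at_most_le t x y : x <= y -> sum_of_at_most t x -> sum_of_at_most t y.
Proof. by move=> xy [r tr rx]; exists r => //; apply: le_trans xy. Qed.

Lemma least_le (B : nat -> Prop) r : B r -> (least B <= r)%N.
Proof.
move=> Br; rewrite /least; case: xgetP => [m _ [_]|none]; first exact.
have exB : exists m, `[< B m >] by exists r; apply/asboolP.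
case: (ex_minnP exB) => m /asboolP Bm m_min.
by case: (none m); split=> // m' Bm'; apply/m_min/asboolP.
Qed.

(** The one property of slices and multi-slices that the rank bound relies on, so that a single
    argument serves both. Both factors are functions on all legs, which avoids indices in
    [legs_on]. *)
Definition splits_on (S : {set 'I_k}) : Prop :=
  forall f g : legs I -> R[i],
    (forall x y : legs I, (forall j, j \in S -> x j = y j) -> f x = f y) ->
    (forall x y : legs I, (forall j, j \notin S -> x j = y j) -> g x = g y) ->
    Q [ffun x : legs I => f x * g x].

End SumsOf.

Section Splits.
Variables (R : realType) (k : nat) (I : 'I_k -> finType).

Lemma restr_eq (S : {set 'I_k}) (x y : legs I) j :
  restr S x = restr S y -> j \in S -> x j = y j.
Proof. by move=> /ffunP E jS; have := E (exist _ j jS); rewrite !ffunE. Qed.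

Definition factor_through (T : finType) (h : legs I -> T) (f : legs I -> R[i]) :
    cspace R T :=
  [ffun a => odflt 0 (omap f [pick x | h x == a])].

Lemma factor_throughE (T : finType) (h : legs I -> T) f x :
  (forall y, h y = h x -> f y = f x) -> factor_through h f (h x) = f x.
Proof.
move=> fP; rewrite ffunE; case: pickP => [y /eqP /fP //|/(_ x)].
by rewrite eqxx.
Qed.

Lemma multislice_splits (S : {set 'I_k}) : S != finset.set0 -> ~: S != finset.set0 ->
  splits_on (@is_multislice R k I) S.
Proof.
move=> S0 CS0 f g fP gP; exists S; split=> //.
exists (factor_through (restr S) f), (factor_through (restr (~: S)) g).
apply/ffunP => x; rewrite [LHS]ffunE [RHS]ffunE; congr (_ * _).
  by rewrite factor_throughE // => y E; apply: fP => j; apply: restr_eq E.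
rewrite factor_throughE // => y E; apply: gP => j jS.
by apply: (restr_eq E); rewrite inE.
Qed.

(** Both blocks are covered because [side] may pick either one; for the complement the two factors
    are exchanged. *)
Lemma slice_splits j (S : {set 'I_k}) : S = [set j] \/ S = ~: [set j] ->
  splits_on (@is_slice R k I) S.
Proof.
have main (f g : legs I -> R[i]) :
    (forall x y : legs I, x j = y j -> f x = f y) ->
    (forall x y : legs I, (forall i, i != j -> x i = y i) -> g x = g y) ->
    is_slice ([ffun x : legs I => f x * g x] : tensor R I).
  move=> fP gP; exists j, (factor_through (fun x => x j) f).
  exists (factor_through (restr (~: [set j])) g).
  apply/ffunP => x; rewrite [LHS]ffunE [RHS]ffunE; congr (_ * _).
    by rewrite (@factor_throughE _ (fun x => x j)) // => y E; apply: fP.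
  rewrite factor_throughE // => y E; apply: gP => i ne_ij.
  by apply: (restr_eq E); rewrite !inE.
move=> [] -> f g fP gP.
- apply: main => [x y E|x y E]; [apply: fP => i | apply: gP => i].
    by rewrite inE => /eqP ->.
  by rewrite inE; exact: E.
- have -> : [ffun x : legs I => f x * g x] = [ffun x : legs I => g x * f x].
    by apply/ffunP => x; rewrite !ffunE mulrC.
  apply: main => [x y E|x y E]; [apply: gP => i | apply: fP => i].
    by rewrite !inE negbK => /eqP ->.
  by rewrite !inE; exact: E.
Qed.

End Splits.

(** * The chain of projections *)

Section Chain.
Variables (R : realType) (k : nat) (I : 'I_k -> finType) (n : nat).
Hypothesis n_gt0 : (0 < n)%N.

Local Notation C := (R[i]).
Local Notation W := (cspace R {ffun 'I_n -> legs I}).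
Local Notation In := (fun j => {ffun 'I_n -> I j} : finType).

Definition transpose_index (y : legs In) : {ffun 'I_n -> legs I} :=
  [ffun m => [ffun j => y j m]].

(** The regrouping of tensor factors from n-fold powers of [V_[k]], where the projections act, to
    [k] legs, where rank is measured. *)
Definition as_ktensor (u : W) : tensor R In := [ffun y => u (transpose_index y)].

Lemma kpowerE (t : tensor R I) : kpower n t = as_ktensor (npower n t).
Proof.
apply/ffunP => y; rewrite !ffunE; apply: eq_bigr => m _.
by rewrite [in RHS]ffunE.
Qed.

Lemma as_ktensor0 : as_ktensor 0 = 0.
Proof. by apply/ffunP => y; rewrite !ffunE. Qed.

Lemma as_ktensor_sum (J : finType) (u : J -> W) :
  as_ktensor (\sum_j u j) = \sum_j as_ktensor (u j).
Proof.
apply/ffunP => y; rewrite !ffunE !sum_ffunE; apply: eq_bigr => j _.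
by rewrite ffunE.
Qed.

Definition symmetric_tensor (u : W) : Prop := forall s, perm_act s u = u.

Lemma npower_symmetric (t : tensor R I) : symmetric_tensor (npower n t).
Proof.
move=> s; apply/ffunP => x; rewrite !ffunE [RHS](reindex_inj (@perm_inj _ s^-1%g)).
by apply: eq_bigr => m _; rewrite ffunE.
Qed.

Lemma symmetrize_id (u : W) : symmetric_tensor u -> symmetrize u = u.
Proof.
move=> u_sym; rewrite /symmetrize; under eq_bigr do rewrite u_sym.
rewrite sumr_const card_Sn -[u *+ _]scaler_nat scalerA mulVf ?scale1r //.
Qed.

Lemma override_restr (S : {set 'I_k}) (x : legs I) : override (restr S x) x = x.
Proof.
by apply/ffunP => j; rewrite ffunE; case: {-}_ / idP => // jS; rewrite ffunE.
Qed.

Lemma override_eq (S : {set 'I_k}) (a : legs_on I S) (x y : legs I) :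
  (forall j, j \notin S -> x j = y j) -> override a x = override a y.
Proof.
move=> xy; apply/ffunP => j; rewrite !ffunE; case: {-}_ / idP => // /negP.
exact: xy.
Qed.

(** Symmetry of [u] turns a permutation of the parameters in the complementary block into a
    permutation of the slice over [side b], and the isotypic projection commutes with the latter. *)
Lemma bipart_proj_symmetric b (P : intpart n) (u : W) : symmetric_tensor u ->
  symmetric_tensor (bipart_proj b (parts P) u).
Proof.
move=> u_sym s; rewrite /bipart_proj symmetrize_id //.
apply/ffunP => x; rewrite [LHS]ffunE [LHS]ffunE [RHS]ffunE.
set v := (X in isotypic_proj _ _ _ _ X _); set v' := (X in _ = isotypic_proj _ _ _ _ X _).
have <- : perm_act s v = v'.
  apply/ffunP => a; rewrite !ffunE -[u in RHS](u_sym s) [RHS]ffunE; congr (u _).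
  by apply/ffunP => m; rewrite !ffunE.
rewrite isotypic_proj_perm_act [RHS]ffunE; congr (fun_of_fin _ _).
by apply/ffunP => m; rewrite !ffunE.
Qed.

Lemma bipart_proj_sum b (u : W) : symmetric_tensor u ->
  \sum_(P : intpart n) bipart_proj b (parts P) u = u.
Proof.
move=> u_sym; apply/ffunP => x; rewrite sum_ffunE.
under eq_bigr do rewrite /bipart_proj symmetrize_id // ffunE.
rewrite -sum_ffunE isotypic_proj_sum ffunE; congr (u _).
by apply/ffunP => m; rewrite !ffunE override_restr.
Qed.

Variable Q : tensor R In -> Prop.

(** In the expansion of the isotypic projection, the vector [v i] sees only the legs in [side b],
    and the coefficient [c i] only the other legs. *)
Lemma bipart_proj_rank b lam (u : W) (d := #|legs_on I (side b)|) :
  splits_on Q (side b) -> is_intpart n lam ->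
  sum_of_at_most Q (as_ktensor (bipart_proj b lam u))
    ((n.+1 ^ (d * d))%:R * 2 `^ (n%:R * entropy R n lam)).
Proof.
move=> splitQ lam_part; rewrite /bipart_proj; move: (symmetrize u) => {}u.
have [r [v [c [le_r projE]]]] := isotypic_proj_rank R (legs_on I (side b)) n_gt0 lam_part.
exists r => //.
pose f i (y : legs In) := v i [ffun m => restr (side b) (transpose_index y m)].
pose g i (y : legs In) := c i [ffun a : {ffun 'I_n -> legs_on I (side b)} =>
  u [ffun m => override (a m) (transpose_index y m)]].
exists (fun i => [ffun y => f i y * g i y]) => [i|].
  apply: splitQ => y y' E.
    rewrite /f; congr (v i _); apply/ffunP => m; rewrite !ffunE.
    by apply/ffunP => -[j jS]; rewrite !ffunE /= E.
  rewrite /g; congr (c i _); apply/ffunP => a; rewrite [LHS]ffunE [RHS]ffunE.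
  congr (u _); apply/ffunP => m; rewrite [LHS]ffunE [RHS]ffunE.
  by apply: override_eq => j jS; rewrite !ffunE E.
apply/ffunP => y; rewrite sum_ffunE [LHS]ffunE [LHS]ffunE projE sum_ffunE.
by apply: eq_bigr => i _; rewrite [LHS]ffunE [RHS]ffunE mulrC.
Qed.

Definition max_leg_dim : nat := \max_(b : bipartition k) #|legs_on I (side b)|.
Local Notation D := max_leg_dim.

(* A term is not projected any further once the entropy of its last partition
   is at most c: it then has small rank across that bipartition. *)
Lemma chain_rank (c : R) (bs : seq (bipartition k)) (u : W) :
  uniq bs -> symmetric_tensor u -> {in bs, forall b, splits_on Q (side b)} ->
  (forall lam, {in bs, forall b, is_intpart n (lam b) /\ c < entropy R n (lam b)} ->
     foldl (fun u b => bipart_proj b (lam b) u) u bs = 0) ->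
  sum_of_at_most Q (as_ktensor u)
    ((n.+1 ^ (D * size bs + D * D))%:R * 2 `^ (n%:R * c)).
Proof.
elim: bs u => [|b bs IH] u.
  (* With no bipartition left, the hypothesis on chains says that [u] itself vanishes. *)
  move=> _ _ _ /(_ (fun _ => [::])) /= -> //; rewrite as_ktensor0.
  by apply: sum_of_at_most0; rewrite mulr_ge0 ?powR_ge0.
move=> /= /andP[b_bs bs_uniq] u_sym splitQ fold0.
set Y := ((n.+1 ^ (D * size bs + D * D))%:R * 2 `^ (n%:R * c)) in IH *.
have Y_ge0 : 0 <= Y by rewrite mulr_ge0 ?powR_ge0.
rewrite -(bipart_proj_sum b u_sym) as_ktensor_sum.
(* Only partitions with at most [D] parts contribute, each at most [Y]. Their number is at most
   (n+1)^D, which is why each bipartition adds [D] to the exponent. *)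
apply: (@sum_of_at_most_le _ _ _ _ _
  (\sum_(P : intpart n) if (size (parts P) <= D)%N then Y else 0)).
  have -> : \sum_(P : intpart n) (if (size (parts P) <= D)%N then Y else 0) =
      Y *+ #|[set P : intpart n | size (parts P) <= D]%N|.
    by rewrite -sumr_const [RHS]big_mkcond /=; apply: eq_bigr => P _; rewrite inE.
  rewrite -mulr_natl /Y mulrA -natrM ler_wpM2r ?powR_ge0 // ler_nat.
  by rewrite mulnS -addnA [X in (_ <= X)%N]expnD leq_mul2r card_short_intpart orbT.
apply: sum_of_at_most_sum => P.
have le_D : (#|legs_on I (side b)| <= D)%N by exact: leq_bigmax.
case: ifP => [_|/negbT]; last first.
  rewrite -ltnNge => lt_D; have -> : bipart_proj b (parts P) u = 0.
    apply/ffunP => x; rewrite [LHS]ffunE isotypic_proj_eq0 ?partsP ?ffunE //.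
    exact: leq_ltn_trans lt_D.
  by rewrite as_ktensor0; apply: sum_of_at_most0.
have [le_c|gt_c] := leP (entropy R n (parts P)) c.
  apply: sum_of_at_most_le (bipart_proj_rank _ _ (partsP P)); last first.
    by apply: splitQ; rewrite mem_head.
  rewrite ler_pM ?powR_ge0 //.
    by rewrite ler_nat leq_pexp2l // (leq_trans (leq_mul le_D le_D)) // leq_addl.
  by rewrite ler_powR ?ler1n // ler_wpM2l.
apply: IH => //; first exact: bipart_proj_symmetric.
  by move=> b' b'_bs; apply: splitQ; rewrite inE b'_bs orbT.
(* A chain along the tail becomes a chain along the whole list by assigning [P] to [b]; since [b] is
   not in [bs], the tail is unaffected. *)
move=> lam lamP; pose lam' b' := if b' == b then parts P else lam b'.
have lam'_b : lam' b = parts P by rewrite /lam' eqxx.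
have fold0' := fold0 lam'; rewrite lam'_b in fold0'.
rewrite -[RHS]fold0'; last first.
  move=> b'; rewrite inE /lam'; case: eqP => [_ _|_ /=]; last exact: lamP.
  by split; [exact: partsP|].
apply: (@eq_foldl_in _ _ (fun u b => bipart_proj b (lam b) u)
  (fun u b => bipart_proj b (lam' b) u)) => b' v b'_bs.
have -> // : lam' b' = lam b'.
by rewrite /lam'; case: eqP => // E; rewrite -E b'_bs in b_bs.
Qed.

End Chain.

(** * Asymptotics *)

Lemma limn_esup_le_near (R : realType) (u : nat -> \bar R) (l : \bar R) (N : nat) :
  (forall n, (N <= n)%N -> (u n <= l)%E) -> (limn_esup u <= l)%E.
Proof.
move=> ule; rewrite /limn_esup /limf_esup.
apply: (@le_trans _ _ (ereal_sup (image [set n | (N <= n)%N] u)%classic)).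
  by apply: ereal_inf_lbound; exists [set n | (N <= n)%N]%classic => //; exists N.
by apply: ge_ereal_sup => _ [n /= Nn <-]; apply: ule.
Qed.

Lemma ln_le_eventually (R : realType) (K : nat) (e : R) : 0 < e ->
  exists2 N : nat, (0 < N)%N &
    forall n, (N <= n)%N -> K%:R * ln (n.+1%:R : R) <= e * n%:R.
Proof.
(* Since ln x <= x for x = (n+1)/M, the logarithm grows with slope at most 1/M, and [M] makes K/M at
   most e/2. The other half of e n absorbs the constants once n passes the threshold below. *)
move=> e_gt0; pose M : R := 2 * K.+1%:R / e.
have M_gt0 : 0 < M by rewrite divr_gt0 // mulr_gt0 // ltr0n.
exists (Num.truncn (1 + 2 * K%:R * `|ln M| / e)).+2 => // n le_n.
have n_big : 1 + 2 * K%:R * `|ln M| / e <= n%:R.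
  apply/ltW/(lt_le_trans (truncnS_gt _)).
  by rewrite ler_nat; apply: leq_trans le_n; rewrite ltnW.
have ln_bound : ln (n.+1%:R : R) <= n.+1%:R / M + `|ln M|.
  have -> : (n.+1%:R : R) = n.+1%:R / M * M by rewrite divfK // gt_eqF.
  have x_gt0 : 0 < n.+1%:R / M by rewrite divr_gt0.
  rewrite {1}lnM ?posrE // mulfK ?gt_eqF // lerD ?ler_norm //.
  exact/ltW/ln_sublinear.
apply: (@le_trans _ _ (K%:R * (n.+1%:R / M + `|ln M|))); first by rewrite ler_wpM2l.
have e_neq0 : e != 0 by rewrite gt_eqF.
have KM : K%:R / M <= e / 2.
  rewrite ler_pdivrMr //; have -> : e / 2 * M = K.+1%:R by rewrite /M; field.
  by rewrite ler_nat.
have KMn : K%:R / M * n.+1%:R <= e / 2 * n.+1%:R by rewrite ler_wpM2r.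
have {}n_big : e + 2 * (K%:R * `|ln M|) <= e * n%:R.
  move: n_big; rewrite -(ler_pM2l e_gt0); congr (_ <= _); field.
  exact: e_neq0.
move: KMn; rewrite mulrDr mulrCA mulrC -natr1; lra.
Qed.

Lemma limn_esup_root_le (R : realType) (a : nat -> R) (K : nat) (c : R) :
  (forall n, 0 <= a n) ->
  (forall n, (0 < n)%N -> a n <= (n.+1 ^ K)%:R * 2 `^ (n%:R * c)) ->
  (limn_esup (fun n => (a n `^ (n%:R^-1))%:E) <= (2 `^ c)%:E)%E.
Proof.
move=> a_ge0 a_le; apply/lee_addgt0Pr => d d_gt0.
have pc_gt0 : 0 < 2 `^ c :> R by rewrite powR_gt0.
(* Chosen so that 2^c exp(e) = 2^c + d; the n-th root of the polynomial factor is eventually at most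
   exp(e). *)
pose e : R := ln (1 + d / 2 `^ c).
have e_gt0 : 0 < e by rewrite ln_gt0 // ltrDl divr_gt0.
have [N N_gt0 lnN] := ln_le_eventually K e_gt0.
apply: (@limn_esup_le_near _ _ _ N) => n le_n; rewrite -EFinD lee_fin.
have n_gt0 : (0 < n)%N by apply: leq_trans le_n.
have nR_gt0 : 0 < n%:R :> R by rewrite ltr0n.
have boundE : (n.+1 ^ K)%:R * 2 `^ (n%:R * c) =
    expR (K%:R * ln n.+1%:R + n%:R * c * ln 2) :> R.
  rewrite expRD natrX; congr (_ * _); last by rewrite /powR gt_eqF.
  by rewrite mulrC expRM_natr lnK // posrE ltr0n.
have -> : 2 `^ c + d = expR (e + c * ln 2).
  rewrite expRD /e lnK; last by rewrite posrE addr_gt0 // divr_gt0.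
  have -> : expR (c * ln 2) = 2 `^ c by rewrite /powR gt_eqF.
  by rewrite mulrDl mul1r divfK // gt_eqF.
apply: (@le_trans _ _ (expR (K%:R * ln n.+1%:R + n%:R * c * ln 2) `^ n%:R^-1)).
  apply: ge0_ler_powR; rewrite ?invr_ge0 ?nnegrE ?expR_ge0 //.
  by rewrite -boundE a_le.
rewrite {1}/powR gt_eqF ?expR_gt0 // expRK ler_expR mulrDr lerD //.
  by rewrite mulrC ler_pdivrMr // lnN.
by rewrite -mulrA mulKf // gt_eqF.
Qed.

(** * The bound on the asymptotic ranks *)

Section Bipartition.
Variable k : nat.

Lemma side_in (b : bipartition k) : side b \in val b.
Proof.
have /andP[_ /eqP card_b] := valP b; rewrite /side; case: pickP => //= none.
by rewrite (eq_card0 none) in card_b.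
Qed.

Lemma side_neq0 (b : bipartition k) : side b != finset.set0.
Proof.
have /andP[/and3P[_ _ b0] _] := valP b.
by apply: contra b0 => /eqP <-; exact: side_in.
Qed.

Lemma side_compl_neq0 (b : bipartition k) : ~: side b != finset.set0.
Proof.
have /andP[/and3P[_ /finset.trivIsetP triv b0] /eqP card_b] := valP b.
have [T /setD1P[neT Tb]] : exists T, T \in val b :\ side b.
  apply/set0Pn; rewrite -card_gt0.
  by have := cardsD1 (side b) (val b); rewrite side_in card_b add1n => -[<-].
have /set0Pn[x xT] : T != finset.set0 by apply: contra b0 => /eqP <-.
apply/set0Pn; exists x; rewrite inE; apply/negP => xS.
have := triv _ _ Tb (side_in b) neT; rewrite -setI_eq0 => /eqP/setP/(_ x).
by rewrite !inE xT xS.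
Qed.

End Bipartition.

Section Bound.
Variables (R : realType) (k : nat) (I : 'I_k -> finType) (t : tensor R I).
Variables (theta : bipartition k -> R) (bs : seq (bipartition k)).
Hypotheses (htheta : is_distribution theta) (hbs : is_support_ordering theta bs).

Local Notation In n := (fun j => {ffun 'I_n -> I j} : finType).
Variable Q : forall n, tensor R (In n) -> Prop.
Hypothesis splitQ : forall n, {in bs, forall b, splits_on (@Q n) (side b)}.
Let rank n : nat := least (is_sum_of (@Q n) (kpower n t)).

Lemma sum_support : \sum_(b <- bs) theta b = 1.
Proof.
have [_ <-] := htheta; have [bs_uniq bsP] := hbs.
rewrite (big_uniq _ bs_uniq) /= [RHS](bigID (mem bs)) /= [X in _ = _ + X]big1 ?addr0 //.
by move=> b; rewrite bsP negbK => /eqP.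
Qed.

(** The inequality stays strict because the weights on [bs] are positive and, summing to 1, not
    vacuous. *)
Lemma average_gt (c : R) (h : bipartition k -> R) :
  {in bs, forall b, c < h b} -> c < \sum_(b <- bs) theta b * h b.
Proof.
move=> lt_ch; have [theta_ge0 _] := htheta; have [_ bsP] := hbs.
rewrite -[ltLHS]mul1r -sum_support mulr_suml -subr_gt0 -sumrB.
under eq_bigr do rewrite -mulrBr.
have term_gt0 : {in bs, forall b, 0 < theta b * (h b - c)}.
  move=> b b_bs; rewrite mulr_gt0 ?subr_gt0 ?lt_ch //.
  by rewrite lt_def theta_ge0 -bsP b_bs.
case: (bs) sum_support term_gt0 => [|b bs'] sum1 term_gt0.
  by have := oner_neq0 R; rewrite -sum1 !big_nil eqxx.
rewrite big_cons ltr_pwDl ?term_gt0 ?mem_head // big_seq sumr_ge0 // => b' b'_bs.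
by rewrite ltW // term_gt0 // inE b'_bs orbT.
Qed.

Lemma rank_le (c : R) n : (0 < n)%N ->
  (log_upper_functional theta bs t <= c%:E)%E ->
  ((rank n)%:R : R) <=
  (n.+1 ^ (max_leg_dim I * size bs + max_leg_dim I * max_leg_dim I))%:R *
    2 `^ (n%:R * c).
Proof.
move=> n_gt0 le_c.
have [|r sum_r le_r] := @chain_rank R k I n n_gt0 (@Q n) c bs (npower n t)
    (proj1 hbs) (npower_symmetric t) (@splitQ n).
  (* A nonzero chain with all entropies above [c] would enter the supremum with an average above
     [c]. *)
  move=> lam lamP; apply/eqP/negPn/negP => fold_neq0.
  have : ((\sum_(b <- bs) theta b * entropy R n (lam b))%:E <= c%:E)%E.
    apply: le_trans le_c; apply: ereal_sup_ubound.
    by exists n, lam; split=> // b /lamP[].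
  by rewrite lee_fin leNgt average_gt // => b /lamP[].
apply: le_trans le_r; rewrite ler_nat; apply: least_le.
by rewrite kpowerE.
Qed.

Lemma asymptotic_rank_le :
  (limn_esup (fun n => ((rank n)%:R `^ (n%:R^-1) : R)%:E) <=
   upper_functional theta bs t)%E.
Proof.
rewrite /upper_functional; case: eqP => [t0|_].
  (* The bound starts at n = 1, since the zeroth power of the zero tensor is an empty product, equal
     to 1. *)
  apply: (@limn_esup_le_near _ _ _ 1) => n n_gt0.
  have -> : rank n = 0%N.
    apply/eqP; rewrite -leqn0; apply: least_le; exists (fun _ => 0); first by case.
    rewrite big_ord0; apply/ffunP => y; rewrite !ffunE (bigD1 (Ordinal n_gt0)) //=.
    by rewrite t0 ffunE mul0r.
  by rewrite powR0 // invr_eq0 pnatr_eq0 -lt0n.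
have key (c : R) : (log_upper_functional theta bs t <= c%:E)%E ->
    (limn_esup (fun n => ((rank n)%:R `^ (n%:R^-1) : R)%:E) <= (2 `^ c)%:E)%E.
  by move=> le_c; apply: limn_esup_root_le => // n n_gt0; exact: rank_le.
have ln2_gt0 : 0 < ln 2 :> R by rewrite ln_gt0 // ltr1n.
have pow2 (c : R) : 2 `^ c = expR (ln 2 * c) by rewrite /powR gt_eqF // mulrC.
case E: (log_upper_functional theta bs t) => [c| |].
- by rewrite -EFinM /= -pow2; apply: key; rewrite E.
- by rewrite gt0_muley ?lte_fin // leey.
(* If the supremum is -oo, [key] holds for every real exponent, so the limit superior is below every
   positive number. *)
- rewrite gt0_muleNy ?lte_fin //=; apply/lee_addgt0Pr => e e_gt0; rewrite add0e.
  have -> : e = 2 `^ (ln e / ln 2).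
    by rewrite pow2 mulrC divfK ?gt_eqF // lnK // posrE.
  by apply: key; rewrite E leNye.
Qed.

End Bound.

Theorem theorem5p3 (R : realType) (k : nat) (hk : (3 <= k)%N)
    (I : 'I_k -> finType) (t : tensor R I)
    (theta : bipartition k -> R) (htheta : is_distribution theta)
    (bs : seq (bipartition k)) (hbs : is_support_ordering theta bs) :
  (asymptotic_multislice_rank t <= upper_functional theta bs t)%E /\
  (singleton_supported theta ->
     (asymptotic_slice_rank t <= upper_functional theta bs t)%E).
Proof.
split=> [|single].
  apply: (asymptotic_rank_le t htheta hbs) => n b _.
  by apply: multislice_splits; [exact: side_neq0 | exact: side_compl_neq0].
apply: (asymptotic_rank_le t htheta hbs) => n b; have [_ ->] := hbs.
case/single => j bE; apply: (@slice_splits _ _ _ j).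
by have := side_in b; rewrite bE => /set2P[]; [left | right].
Qed.
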